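(* Let $d\ge 3$. Then any linear automorphism $\mathbf A$ of $L_{d,d+2}$ is a scalar multiple of a signed permutation that is induced by a vertex relabeling.
   Context: Let $n=d+2$, $N=\binom n2$, and index the coordinates of $\mathbb C^N$ by the edges $ij$ ($1\le i<j\le n$) of the complete graph $K_n$. For a complex configuration $\mathbf p=(\mathbf p_1,\dots,\mathbf p_n)$ of points in $\mathbb C^d$ put $m_{ij}(\mathbf p)=\sum_{k=1}^d(\mathbf p_i^k-\mathbf p_j^k)^2$ (no conjugation) and $m(\mathbf p)=(m_{ij}(\mathbf p))_{ij}\in\mathbb C^N$. $M_{d,n}\subset\mathbb C^N$ is the image of $m$ over all complex configurations, $s:\mathbb C^N\to\mathbb C^N$ is the coordinate-wise squaring map, and $L_{d,n}:=s^{-1}(M_{d,n})$. A linear automorphism of $L_{d,n}$ is a non-singular complex $N\times N$ matrix $\mathbf A$ with $\mathbf A(L_{d,n})=L_{d,n}$. A signed permutation is a matrix $\mathbf S\mathbf P$ with $\mathbf S$ diagonal with entries $\pm1$ and $\mathbf P$ an $N\times N$ permutation matrix; it is induced by a vertex relabeling if $\mathbf P$ is the permutation of the edges of $K_n$ induced by a permutation of the vertices $\{1,\dots,n\}$. *)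

(* Defs.v *)
From HB Require Import structures.
From mathcomp Require Import all_boot all_order all_fingroup all_algebra.
From mathcomp Require Import complex.
From mathcomp Require Import boolp classical_sets reals.

Set Implicit Arguments.
Unset Strict Implicit.
Unset Printing Implicit Defensive.

Import GRing.Theory.
Local Open Scope ring_scope.
Local Open Scope classical_set_scope.

Definition edge (n : nat) : finType := {e : 'I_n * 'I_n | (e.1 < e.2)%N}.

(* Coordinates of C^N are numbered by 'I_N through [enum_val]. *)
Definition nedges (n : nat) : nat := #|edge n|.

Definition src (n : nat) (k : 'I_(nedges n)) : 'I_n := (val (enum_val k)).1.
Definition tgt (n : nat) (k : 'I_(nedges n)) : 'I_n := (val (enum_val k)).2.

Definition endpoints (n : nat) (k : 'I_(nedges n)) : {set 'I_n} :=
  [set src k; tgt k]%SET.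

Lemma nedgesE (n : nat) : nedges n = 'C(n, 2).
Proof.
rewrite /nedges card_sig -sum1_card.
rewrite (eq_bigl (fun e : 'I_n * 'I_n => e.1 < e.2)%N) //.
rewrite -(pair_big_dep xpredT (fun i j : 'I_n => (i < j)%N) (fun _ _ => 1%N)) /=.
rewrite (exchange_big_dep xpredT) //= -bin2_sum big_mkord.
apply: eq_bigr => j _.
rewrite -(big_ord_widen n (fun=> 1%N)) ?(ltnW (ltn_ord j)) //.
by rewrite sum1_card card_ord.
Qed.

Section MeasurementVarieties.
Variables (R : realType) (d n : nat).
Local Notation C := (R[i]).
Local Notation N := (nedges n).

(* The bilinear, not Hermitian, square: there is no conjugation. *)
Definition measure (p : 'I_n -> 'rV[C]_d) : 'cV[C]_N :=
  \col_(k < N) \sum_(l < d) (p (src k) 0 l - p (tgt k) 0 l) ^+ 2.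

Definition M_variety : set 'cV[C]_N := range measure.

Definition square_map (v : 'cV[C]_N) : 'cV[C]_N := \col_k (v k 0) ^+ 2.

Definition L_variety : set 'cV[C]_N := square_map @^-1` M_variety.

Definition linear_automorphism (A : 'M[C]_N) (L : set 'cV[C]_N) : Prop :=
  A \in unitmx /\ [set A *m v | v in L] = L.

Definition sign_mx (S : 'M[C]_N) : Prop :=
  exists2 e : 'rV[C]_N, S = diag_mx e & forall k, e 0 k = 1 \/ e 0 k = -1.

(* Stated on unordered endpoints because t need not preserve i < j. *)
Definition induces (t : 'S_n) (s : 'S_N) : Prop :=
  forall k : 'I_N, endpoints (s k) = (t @: endpoints k)%SET.

(* [perm_mx s] sends v to (v (s k))_k; its transpose is [perm_mx s^-1], and
   s^-1 is induced by t^-1, so the choice of convention is immaterial. *)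
Definition relabeling_signed_perm (B : 'M[C]_N) : Prop :=
  exists (S : 'M[C]_N) (s : 'S_N),
    [/\ sign_mx S, (exists t : 'S_n, induces t s) & B = S *m perm_mx s].

End MeasurementVarieties.

Arguments M_variety : clear implicits.
Arguments L_variety : clear implicits.

(* Main.v *)
Require Import Defs.
From mathcomp Require Import all_boot all_order all_fingroup all_algebra all_field.
From mathcomp Require Import complex.
From mathcomp Require Import boolp classical_sets reals.
From mathcomp Require Import ring zify.

(** The theorem is about the group of a hypersurface. Put one vertex at the origin:
    a vector of squared lengths is then the same thing as a symmetric matrix of size
    d + 1 (its Gram matrix), and it is realized by points of C^d if and only if this
    matrix is singular. So L is the zero set of F(x) = det gram (x_k ^ 2), the
    Cayley-Menger determinant in squared coordinates ([L_varietyP]).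

    An automorphism A of L preserves F up to a constant ([cmdet_proportional]). Indeed F
    and its composite with A have the same zeros and degrees bounded by deg F, and F has
    only simple roots on some line, hence on almost every line.

    Therefore A preserves the order of vanishing of F at points. At a nonzero point w this
    order is at least 2 d if and only if w is a star: its coordinates are zero except on
    the edges at one vertex, where their squares are equal ([mult_of_star],
    [star_of_mult]). For the harder direction, let r be the rank of the Gram matrix of
    w ^ 2. Deforming squared lengths at second order makes F vanish to order
    2 (d + 1 - r) only, so r <= 1 and w measures points on a line. Deforming at first order
    one edge ij with w_ij <> 0 lowers the order below 2 d, unless the product of the i-th
    and j-th coordinates is zero on the kernel of the Gram matrix; this happens only when
    all the points but one coincide.

    So A permutes the lines spanned by stars. There are finitely many signed stars at each
    vertex, and with n >= 5 vertices (this is where d >= 3 enters) the linear relations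
    among them show that two stars at i differing by one sign go to stars at one and the
    same vertex ([flip_same_vertex]). Their difference is the vector of an edge, so A maps
    the vector of the edge ij to a vector supported on the edges common to two vertices
    f i and f j, which is a multiple of the vector of a single edge. This gives a monomial
    matrix induced by f, and equality of the squares of its entries comes once more from
    the images of stars ([star_preserving_monomial]). *)

Set Implicit Arguments.
Unset Strict Implicit.
Unset Printing Implicit Defensive.

Import Order.TTheory GRing.Theory Num.Theory.
Local Open Scope ring_scope.
Local Notation mxC := (map_mx polyC).

(** * Determinants of polynomial matrices and symmetric forms *)

(** Row i carries a factor 'X^(a i) and column j a factor 'X^(b j); both come out
    of the determinant. All orders of vanishing below are computed this way, by
    choosing the weights so that the cofactor is a unit at 0. *)
Lemma det_rescale (R : comNzRingType) k (W V : 'M[{poly R}]_k)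
    (a b : 'I_k -> nat) :
  (forall i j, W i j = V i j * 'X^(a i + b j)) ->
  \det W = \det V * 'X^(\sum_i a i + \sum_i b i).
Proof.
move=> eqW.
have -> : W = diag_mx (\row_i 'X^(a i)) *m V *m diag_mx (\row_i 'X^(b i)).
  apply/matrixP=> i j; rewrite mul_mx_diag mul_diag_mx !mxE eqW exprD.
  by rewrite mulrCA mulrA.
rewrite !det_mulmx !det_diag.
under eq_bigr do rewrite mxE; under [X in _ * X]eq_bigr do rewrite mxE.
by rewrite !prodrXr mulrAC mulrC exprD.
Qed.

Lemma det_order (F : fieldType) k (W V : 'M[{poly F}]_k)
    (a b : 'I_k -> nat) m :
  (forall i j, W i j = V i j * 'X^(a i + b j)) ->
  \det (map_mx (horner_eval 0) V) != 0 ->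
  'X^m %| \det W -> (m <= \sum_i a i + \sum_i b i)%N.
Proof.
move=> eqW; rewrite det_map_mx (det_rescale eqW); move: (\sum_i a i + _)%N => s.
move=> nzV; apply: contraTT; rewrite -ltnNge => lt_sm; apply: contra nzV.
have -> : (m = (m - s.+1) + 1 + s)%N by rewrite addn1 addSnnS subnK.
rewrite !exprD expr1 dvdp_mul2r ?expf_neq0 ?polyX_eq0 // => /dvdpP[q ->].
by rewrite mulrA rmorphM /= /horner_eval hornerX mulr0.
Qed.

(** Gaussian elimination: any column becomes a multiple of the first basis vector
    in a suitable basis of the space. *)
Lemma col_reduce (F : fieldType) n (x : 'cV[F]_n.+1) :
  exists2 U : 'M_n.+1, U \in unitmx & exists c, U *m x = c *: delta_mx 0 0.
Proof.
exists (invmx (col_ebase x)); first by rewrite unitmx_inv col_ebase_unit.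
exists ((0 < \rank x)%N%:R * row_ebase x 0 0).
rewrite -{2}(mulmx_ebase x) -mulmxA mulKmx ?col_ebase_unit //.
apply/matrixP=> i j; rewrite !ord1 !mxE big_ord1 !mxE eqxx andbT.
have rk1 : (\rank x <= 1)%N by rewrite rank_leq_col.
case: (i =P 0) => [->|/eqP ni0]; first by rewrite eqxx /= mulr1.
suff -> : (i == 0 :> nat)%N = false by rewrite !mul0r mulr0.
by apply: contraNF ni0.
Qed.

Lemma congr_diag_block (R : comNzRingType) n (A : 'M[R]_1) (P Q : 'M[R]_n) :
  block_mx A 0 0 P *m block_mx 1%:M 0 0 Q *m (block_mx A 0 0 P)^T =
  block_mx (A *m A^T) 0 0 (P *m Q *m P^T).
Proof.
rewrite tr_block_mx !mulmx_block !(trmx0, mul0mx, mulmx0, addr0, add0r).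
by rewrite mulmx1.
Qed.

Lemma scalar_mx1_eq0 (R : nzRingType) (c : R) : (c%:M == 0 :> 'M_1) = (c == 0).
Proof.
apply/eqP/eqP => [/matrixP/(_ 0 0)|->]; last exact: raddf0.
by rewrite !mxE eqxx.
Qed.

(** Polarization: if x^T Q x vanished for all x, so would the entries of Q,
    because 2 is invertible. *)
Lemma sym_pivot (F : numFieldType) n (Q : 'M[F]_n) :
  Q^T = Q -> Q != 0 -> exists x : 'cV_n, x^T *m Q *m x != 0.
Proof.
move=> symQ nzQ.
have qE i j : (delta_mx i 0 : 'cV_n)^T *m Q *m (delta_mx j 0 : 'cV_n) = (Q i j)%:M.
  by rewrite trmx_delta -rowE -colE; apply/matrixP=> a b; rewrite !ord1 !mxE eqxx.
case: (pickP (fun p : 'I_n * 'I_n => Q p.1 p.2 != 0)) => [[i j]/= nzij|Q0]; last first.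
  case/eqP: nzQ; apply/matrixP=> i j; rewrite mxE.
  by apply/eqP; have /negbFE := Q0 (i, j).
have symij : Q j i = Q i j by rewrite -{1}symQ mxE.
have [Qii|nz] := eqVneq (Q i i) 0; last first.
  by exists (delta_mx i 0); rewrite qE scalar_mx1_eq0.
have [Qjj|nz] := eqVneq (Q j j) 0; last first.
  by exists (delta_mx j 0); rewrite qE scalar_mx1_eq0.
exists (delta_mx i 0 + delta_mx j 0).
rewrite [_^T]linearD /= !mulmxDl !mulmxDr !qE Qii Qjj symij.
rewrite (raddf0 (@scalar_mx F 1)) add0r addr0 -raddfD scalar_mx1_eq0 -mulr2n.
by rewrite mulrn_eq0.
Qed.

(** Over an algebraically closed field a symmetric matrix is congruent to a partial
    identity matrix: split off a vector on which the form does not vanish,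
    normalize it by a square root, and induct on the complement. *)
Lemma sym_normal_form (C : numClosedFieldType) n (Q : 'M[C]_n) :
  Q^T = Q -> exists2 P : 'M_n, P \in unitmx &
    exists2 r, (r <= n)%N & Q = P *m pid_mx r *m P^T.
Proof.
elim: n Q => [|n IHn] Q symQ.
  by exists 1%:M; rewrite ?unitmx1 //; exists 0%N; rewrite // [LHS]flatmx0 [RHS]flatmx0.
have [->|nzQ] := eqVneq Q 0.
  exists 1%:M; rewrite ?unitmx1 //; exists 0%N => //.
  by rewrite pid_mx_0 mulmx0 mul0mx.
have [x nzx] := sym_pivot symQ nzQ.
have [U Uu [c Ux]] := col_reduce x.
have Dx : x = invmx U *m (c *: delta_mx 0 0) by rewrite -Ux mulKmx.
pose Q1 : 'M_(1 + n) := (invmx U)^T *m Q *m invmx U.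
have symQ1 : Q1^T = Q1 by rewrite /Q1 !trmx_mul trmxK symQ mulmxA.
pose a := Q1 0 0.
have nza : a != 0.
  apply: contraNneq nzx => a0.
  rewrite Dx trmx_mul linearZ /= trmx_delta.
  have -> : c *: delta_mx 0 0 *m (invmx U)^T *m Q *m (invmx U *m (c *: delta_mx 0 0))
    = c *: (c *: (delta_mx 0 0 *m Q1 *m delta_mx 0 0)) :> 'M_1.
    by rewrite /Q1 -!scalemxAl -!scalemxAr !mulmxA.
  rewrite -rowE -colE; have -> : col 0 (row 0 Q1) = 0.
    by apply/matrixP=> i j; rewrite mxE [LHS]mxE -/a a0 mxE.
  by rewrite !scaler0.
pose v := dlsubmx Q1; pose D := drsubmx Q1.
have EQ1 : Q1 = block_mx a%:M v^T v D.
  rewrite -[LHS]submxK /v /D trmx_dlsub symQ1; congr block_mx.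
  rewrite [LHS]mx11_scalar; congr _%:M; rewrite [LHS]mxE [LHS]mxE.
  by rewrite /a; congr (Q1 _ _); apply/val_inj.
have symD : D^T = D by rewrite /D trmx_drsub symQ1.
have /IHn [P' uP' [r ler ED]] : (D - a^-1 *: (v *m v^T))^T = D - a^-1 *: (v *m v^T).
  by rewrite linearB linearZ /= trmx_mul trmxK symD.
pose L : 'M_(1 + n) := block_mx 1%:M 0 (a^-1 *: v) 1%:M.
pose P1 : 'M_(1 + n) := block_mx (sqrtC a)%:M 0 0 P'.
have uL : L \in unitmx by rewrite unitmxE det_lblock !det1 mulr1 unitr1.
have uP1 : P1 \in unitmx.
  rewrite unitmxE det_lblock det_scalar1 unitrM -unitmxE uP' andbT unitfE.
  by rewrite sqrtC_eq0.
exists (U^T *m (L *m P1)); first by rewrite !unitmx_mul unitmx_tr Uu uL uP1.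
exists r.+1 => //.
have -> : pid_mx r.+1 = block_mx 1%:M 0 0 (pid_mx r) :> 'M[C]_(1 + n).
  rewrite -[LHS]submxK; congr block_mx; apply/matrixP=> i j; rewrite !mxE //=.
  - by rewrite !ord1.
  - by rewrite ord1.
  - by rewrite ord1.
have EQ : Q = U^T *m Q1 *m U.
  by rewrite /Q1 !mulmxA -trmx_mul mulVmx // trmx1 mul1mx -mulmxA mulVmx ?mulmx1.
rewrite [LHS]EQ !trmx_mul trmxK !mulmxA; congr (_ *m _).
rewrite -!mulmxA; congr (_ *m _).
transitivity (L *m (P1 *m block_mx 1%:M 0 0 (pid_mx r) *m P1^T) *m L^T); last first.
  by rewrite !mulmxA.
rewrite congr_diag_block -ED tr_scalar_mx -scalar_mxM -expr2 sqrtCK.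
rewrite /L tr_block_mx !mulmx_block !(trmx0, trmx1, mul0mx, mulmx0, addr0, add0r).
rewrite !(mulmx1, mul1mx) mul_mx_scalar mul_scalar_mx [(_ *: v)^T]linearZ /=.
rewrite -!scalemxAl -!scalemxAr !scalerA divff // !scale1r mul1r addrC subrK.
by rewrite -EQ1 /Q1 mulmxA.
Qed.

(** * Edge vectors and Gram matrices *)

Section Edges.
Variable n : nat.
Implicit Types (k h : 'I_(nedges n)) (i j : 'I_n).

Lemma src_lt_tgt k : (src k < tgt k)%N.
Proof. exact: (valP (enum_val k)). Qed.

Lemma src_neq_tgt k : src k != tgt k.
Proof. by rewrite neq_ltn src_lt_tgt. Qed.

Lemma in_endpoints k i : (i \in endpoints k) = (i == src k) || (i == tgt k).
Proof. by rewrite !inE. Qed.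

Lemma endpoints_inj : injective (@endpoints n).
Proof.
move=> k h Ekh; apply/enum_val_inj/val_inj.
have lk := src_lt_tgt k; have lh := src_lt_tgt h.
have := in_endpoints h (src k); have := in_endpoints h (tgt k).
rewrite -Ekh !inE !eqxx orbT /= => /esym/orP e1 /esym/orP e2.
suff [e3 e4] : src k = src h /\ tgt k = tgt h.
  by rewrite [LHS]surjective_pairing [RHS]surjective_pairing; congr (_, _).
case: e1 e2 => /eqP e1 [] /eqP e2; rewrite e1 e2 in lk *.
- by rewrite ltnn in lk.
- by move: (ltn_trans lk lh); rewrite ltnn.
- by [].
- by rewrite ltnn in lk.
Qed.

Lemma edge_exists i j : i != j -> exists k, endpoints k = [set i; j]%SET.
Proof.
wlog lt_ij : i j / (i < j)%N => [hw|_].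
  move=> nij; have := nij; rewrite neq_ltn => /orP[/hw|/hw]; first by apply.
  by rewrite finset.setUC; apply; rewrite eq_sym.
exists (enum_rank (exist (fun e : 'I_n * 'I_n => (e.1 < e.2)%N) (i, j) lt_ij : edge n)).
by rewrite /endpoints /src /tgt enum_rankK.
Qed.

Lemma endpoints_set2 k i j : i != j -> i \in endpoints k -> j \in endpoints k ->
  endpoints k = [set i; j]%SET.
Proof.
rewrite !in_endpoints => nij /orP[]/eqP ei /orP[]/eqP ej; subst i j.
- by rewrite eqxx in nij.
- by [].
- by rewrite finset.setUC.
- by rewrite eqxx in nij.
Qed.
End Edges.

Section Dist.
Variables (R : comNzRingType) (n : nat).
Local Notation N := (nedges n).
Implicit Types x y : 'cV[R]_N.

(** The symmetric matrix of squared lengths attached to a vector of edge values. The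
    sum has exactly one term off the diagonal and none on it, which makes linearity
    in the vector and compatibility with ring morphisms immediate. *)
Definition dist x : 'M[R]_n :=
  \matrix_(i, j) \sum_(k < N | endpoints k == [set i; j]%SET) x k 0.

Lemma dist_edge x k i j : endpoints k = [set i; j]%SET -> dist x i j = x k 0.
Proof.
move=> Ek; rewrite mxE (bigD1 k) /= ?Ek // big1 ?addr0 // => h /andP[/eqP Eh].
by case/eqP; apply: endpoints_inj; rewrite Ek.
Qed.

Lemma dist_src_tgt x k : dist x (src k) (tgt k) = x k 0.
Proof. exact: dist_edge. Qed.

Lemma dist_diag x i : dist x i i = 0.
Proof.
rewrite mxE big_pred0 // => k; apply/negP=> /eqP Ek.
have := src_neq_tgt k.
have : src k \in endpoints k by rewrite in_endpoints eqxx.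
have : tgt k \in endpoints k by rewrite in_endpoints eqxx orbT.
by rewrite Ek !inE !orbb => /eqP-> /eqP->; rewrite eqxx.
Qed.

Lemma dist_tr x : (dist x)^T = dist x.
Proof. by apply/matrixP=> i j; rewrite !mxE finset.setUC. Qed.

Lemma distC x i j : dist x i j = dist x j i.
Proof. by rewrite -{1}dist_tr mxE. Qed.

Lemma dist_col (f : 'I_n -> 'I_n -> R) i j : (forall i j, f i j = f j i) ->
  i != j -> dist (\col_k f (src k) (tgt k)) i j = f i j.
Proof.
move=> symf nij; have [k Ek] := edge_exists nij.
rewrite (dist_edge _ Ek) mxE.
have : src k \in endpoints k by rewrite in_endpoints eqxx.
have : tgt k \in endpoints k by rewrite in_endpoints eqxx orbT.
have := src_neq_tgt k; rewrite Ek !inE.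
by move=> ne /orP[]/eqP e1 /orP[]/eqP e2; rewrite e1 e2 ?eqxx // in ne *.
Qed.

Lemma distD x y : dist (x + y) = dist x + dist y.
Proof.
by apply/matrixP=> i j; rewrite !mxE -big_split; apply: eq_bigr => k _; rewrite mxE.
Qed.

Lemma distZ c x : dist (c *: x) = c *: dist x.
Proof.
by apply/matrixP=> i j; rewrite !mxE mulr_sumr; apply: eq_bigr => k _; rewrite mxE.
Qed.
End Dist.

Lemma dist_map (R S : comNzRingType) (f : {rmorphism R -> S}) n
  (x : 'cV[R]_(nedges n)) : dist (map_mx f x) = map_mx f (dist x).
Proof.
by apply/matrixP=> i j; rewrite !mxE rmorph_sum; apply: eq_bigr => k _; rewrite mxE.
Qed.

Section Gram.
Variables (R : comNzRingType) (m : nat).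
Local Notation N := (nedges m.+1).
Implicit Types x y : 'cV[R]_N.

(** Row j is e_(j+1) - e_0: the vectors from vertex 0 to the other vertices. *)
Definition base_mx : 'M[R]_(m, m.+1) :=
  \matrix_(j, i) ((i == lift ord0 j)%:R - (i == ord0)%:R).

(** For the squared lengths of points p_i, the entries of this matrix are twice the
    scalar products of the vectors p_j - p_0. *)
Definition gram x : 'M[R]_m := - (base_mx *m dist x *m base_mx^T).

Lemma base_mxl p (A : 'M[R]_(m.+1, p)) j i :
  (base_mx *m A) j i = A (lift ord0 j) i - A ord0 i.
Proof.
rewrite mxE; under eq_bigr do rewrite mxE mulrBl.
rewrite sumrB; congr (_ - _).
  rewrite (bigD1 (lift ord0 j)) //= eqxx mul1r big1 ?addr0 // => l /negPf->.
  by rewrite mul0r.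
rewrite (bigD1 ord0) //= mul1r big1 ?addr0 // => l /negPf->.
by rewrite mul0r.
Qed.

Lemma base_mxr p (A : 'M[R]_(p, m.+1)) j i :
  (A *m base_mx^T) i j = A i (lift ord0 j) - A i ord0.
Proof.
have := base_mxl A^T j i; rewrite !mxE => <-.
by apply: eq_bigr => k _; rewrite !mxE mulrC.
Qed.

Lemma gram_entry x j k : gram x j k =
  dist x (lift ord0 j) ord0 + dist x ord0 (lift ord0 k)
    - dist x (lift ord0 j) (lift ord0 k).
Proof.
rewrite mxE base_mxr !base_mxl dist_diag; ring.
Qed.

Lemma gram_tr x : (gram x)^T = gram x.
Proof. by rewrite /gram linearN /= !trmx_mul trmxK dist_tr mulmxA. Qed.

Lemma gramD x y : gram (x + y) = gram x + gram y.
Proof. by rewrite /gram distD mulmxDr mulmxDl opprD. Qed.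

Lemma gramZ c x : gram (c *: x) = c *: gram x.
Proof. by rewrite /gram distZ -scalemxAr -scalemxAl scalerN. Qed.

Definition sqv x : 'cV[R]_N := map_mx (fun z => z ^+ 2) x.

(** The Cayley-Menger determinant of the squares of the coordinates, as a polynomial
    expression over an arbitrary commutative ring. *)
Definition cmdet x : R := \det (gram (sqv x)).
End Gram.

Lemma gram_map (R S : comNzRingType) (f : {rmorphism R -> S}) m
  (x : 'cV[R]_(nedges m.+1)) : gram (map_mx f x) = map_mx f (gram x).
Proof.
apply/matrixP=> i j; rewrite [RHS]mxE !gram_entry dist_map !mxE.
by rewrite rmorphB rmorphD.
Qed.

Lemma cmdet_map (R S : comNzRingType) (f : {rmorphism R -> S}) m
  (x : 'cV[R]_(nedges m.+1)) : cmdet (map_mx f x) = f (cmdet x).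
Proof.
rewrite /cmdet -det_map_mx -gram_map; congr (\det (gram _)).
by apply/matrixP=> i j; rewrite !mxE rmorphXn.
Qed.

Section Ungram.
Variables (F : numFieldType) (m : nat).
Local Notation N := (nedges m.+1).

(** Inserts a zero row for the base vertex 0; it turns a Gram matrix based at vertex 0
    into a form on all the vertices. *)
Definition pad_mx : 'M[F]_(m.+1, m) := \matrix_(i, j) (i == lift ord0 j)%:R.

Definition polarize (Q : 'M[F]_m.+1) : 'cV[F]_N :=
  \col_k ((Q (src k) (src k) + Q (tgt k) (tgt k)) / 2 - Q (src k) (tgt k)).

(** The inverse of [gram] on symmetric matrices, by the polarization identity. *)
Definition ungram (Q : 'M[F]_m) : 'cV[F]_N := polarize (pad_mx *m Q *m pad_mx^T).

Lemma pad_mx_lift p (A : 'M[F]_(m, p)) j i : (pad_mx *m A) (lift ord0 j) i = A j i.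
Proof.
rewrite mxE (bigD1 j) //= big1 ?addr0 => [|l]; rewrite mxE.
  by rewrite eqxx mul1r.
by rewrite (inj_eq lift_inj) eq_sym => /negPf->; rewrite mul0r.
Qed.

Lemma pad_mx0 p (A : 'M[F]_(m, p)) i : (pad_mx *m A) ord0 i = 0.
Proof. by rewrite mxE big1 // => l _; rewrite mxE /= mul0r. Qed.

Lemma pad_conj_lift (Q : 'M[F]_m) j k :
  (pad_mx *m Q *m pad_mx^T) (lift ord0 j) (lift ord0 k) = Q j k.
Proof.
by rewrite -mulmxA pad_mx_lift -[_ *m _]trmxK mxE trmx_mul trmxK pad_mx_lift mxE.
Qed.

Lemma pad_conj0l (Q : 'M[F]_m) i : (pad_mx *m Q *m pad_mx^T) ord0 i = 0.
Proof. by rewrite -mulmxA pad_mx0. Qed.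

Lemma pad_conj0r (Q : 'M[F]_m) i : (pad_mx *m Q *m pad_mx^T) i ord0 = 0.
Proof. by rewrite -[_ *m _ *m _]trmxK mxE trmx_mul trmxK pad_mx0. Qed.

Lemma dist_polarize (Q : 'M[F]_m.+1) i j : Q^T = Q ->
  dist (polarize Q) i j = (Q i i + Q j j) / 2 - Q i j.
Proof.
move=> symQ; have [->|nij] := eqVneq i j; first by rewrite dist_diag; field.
rewrite (dist_col (f := fun i j => (Q i i + Q j j) / 2 - Q i j)) // => k l.
by rewrite -{3}symQ mxE [Q k k + _]addrC.
Qed.

Lemma gram_ungram (Q : 'M[F]_m) : Q^T = Q -> gram (ungram Q) = Q.
Proof.
move=> symQ; apply/matrixP=> j k; rewrite gram_entry.
have symP : (pad_mx *m Q *m pad_mx^T)^T = pad_mx *m Q *m pad_mx^T.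
  by rewrite !trmx_mul trmxK symQ mulmxA.
rewrite !dist_polarize //.
rewrite !pad_conj_lift !pad_conj0l !pad_conj0r; by field.
Qed.

Lemma ungram_gram x : ungram (gram x) = x.
Proof.
set G := pad_mx *m gram x *m pad_mx^T.
have GE i j : G i j = dist x i ord0 + dist x ord0 j - dist x i j.
  case: (unliftP ord0 i) => [i' ->|->]; last first.
    by rewrite /G pad_conj0l dist_diag add0r subrr.
  case: (unliftP ord0 j) => [j' ->|->]; last first.
    by rewrite /G pad_conj0r dist_diag addr0 subrr.
  by rewrite pad_conj_lift gram_entry.
apply/matrixP=> k c; rewrite ord1 mxE !GE !dist_diag !(distC _ ord0) dist_src_tgt.
by field.
Qed.

Lemma gram_inj : injective (@gram F m).
Proof. exact: can_inj ungram_gram. Qed.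
End Ungram.

(** * The variety as a hypersurface *)

Lemma measure_gram (R : realType) (d : nat) (p : 'I_d.+2 -> 'rV[R[i]]_d) :
  exists Z : 'M_(d.+1, d), gram (measure p) = Z *m Z^T.
Proof.
exists (sqrtC 2 *: (\matrix_(j, l) (p (lift ord0 j) 0 l - p ord0 0 l))).
have distM i j : dist (measure p) i j = \sum_(l < d) (p i 0 l - p j 0 l) ^+ 2.
  have [->|nij] := eqVneq i j.
    by rewrite dist_diag big1 // => l _; rewrite subrr expr0n.
  apply: (dist_col (f := fun i j => \sum_(l < d) (p i 0 l - p j 0 l) ^+ 2)) => // k h.
  by apply: eq_bigr => l _; rewrite -sqrrN opprB.
rewrite linearZ /= -scalemxAl -scalemxAr scalerA -expr2 sqrtCK.
apply/matrixP=> j k; rewrite gram_entry !distM !mxE -big_split -sumrB mulr_sumr.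
by apply: eq_bigr => l _ /=; rewrite !mxE; ring.
Qed.

(** The rows of Z, with the base vertex at the origin, are the points of the
    configuration; the factor sqrt 2 compensates the factor 2 in [gram]. *)
Lemma gram_measure (R : realType) (d : nat) (v : 'cV[R[i]]_(nedges d.+2))
    (Z : 'M_(d.+1, d)) : gram v = Z *m Z^T -> M_variety R d d.+2 v.
Proof.
move=> EZ; exists (fun i => (sqrtC 2)^-1 *: row i (pad_mx _ _ *m Z)) => //.
have YE : pad_mx _ _ *m gram v *m (pad_mx _ _)^T
    = (pad_mx _ _ *m Z) *m (pad_mx _ _ *m Z)^T by rewrite EZ trmx_mul !mulmxA.
apply/matrixP=> k c; rewrite ord1 -(ungram_gram v) /ungram YE.
move: (pad_mx _ _ *m Z) => Y; rewrite [LHS]mxE [RHS]mxE.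
rewrite ![(Y *m Y^T) _ _]mxE -big_split mulr_suml -sumrB /=.
apply: eq_bigr => l _; rewrite !mxE.
rewrite -mulrBr exprMn exprVn sqrtCK; by field.
Qed.

(** A singular symmetric matrix of size d+1 has rank at most d, so its normal form
    factors it through C^d: every singular Gram matrix is realized by points. *)
Lemma L_varietyP (R : realType) (d : nat) (x : 'cV[R[i]]_(nedges d.+2)) :
  L_variety R d d.+2 x <-> cmdet x = 0.
Proof.
have Esq : square_map x = sqv x by apply/matrixP=> k c; rewrite ord1 !mxE.
rewrite /L_variety /preimage /= Esq /cmdet; move: (sqv x) => v; split.
  case=> p _ <-; have [Z ->] := measure_gram p.
  apply/eqP; apply: contraTT (leqnn d) => nz; rewrite -ltnNge.
  have : \rank (Z *m Z^T) = d.+1 by apply: mxrank_unit; rewrite unitmxE unitfE.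
  by move=> <-; apply: leq_trans (mxrankM_maxl _ _) (rank_leq_col _).
move=> det0; have [P uP [r ler EG]] := sym_normal_form (gram_tr v).
have lerd : (r <= d)%N.
  rewrite -ltnS ltn_neqAle ler andbT; apply: contra_eq_neq det0 => er.
  rewrite EG er pid_mx_1 mulmx1 det_mulmx det_tr mulf_neq0 //;
  by rewrite -unitfE -unitmxE.
apply: (@gram_measure _ _ _ (P *m pid_mx r)).
by rewrite EG trmx_mul tr_pid_mx -!mulmxA; congr (_ *m _); rewrite mulmxA pid_mx_id.
Qed.

(** * Multiplicity of stars *)

(** The edge vectors proportional to a signed sum of all the edges at the vertex i;
    prescribing the squares leaves the signs free. *)
Definition star (C : numClosedFieldType) n (i : 'I_n) (w : 'cV[C]_(nedges n)) :=
  exists2 l, l != 0 & forall k, w k 0 ^+ 2 = l * (i \in endpoints k)%:R.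

(** The polynomial [cmdet] vanishes to order at least q at w, tested on lines. *)
Definition has_mult (C : numClosedFieldType) m q (w : 'cV[C]_(nedges m.+1)) :=
  forall u, 'X^q %| cmdet (mxC w + 'X *: mxC u).

Lemma gram_quadratic (R : comNzRingType) m (w u : 'cV[R]_(nedges m.+1)) :
  gram (sqv (mxC w + 'X *: mxC u)) =
  mxC (gram (sqv w)) + 'X *: mxC (gram (\col_k (2 * w k 0 * u k 0)))
    + 'X^2 *: mxC (gram (sqv u)).
Proof.
rewrite -!gram_map -!gramZ -!gramD; congr gram; apply/matrixP=> k c.
by rewrite ord1 !mxE !rmorphXn !rmorphM rmorph_nat /=; ring.
Qed.

Section StarGram.
Variables (C : numClosedFieldType) (m : nat) (i : 'I_m.+1).
Implicit Type y : 'cV[C]_(nedges m.+1).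
Local Notation b := (col i (base_mx C m)).

Lemma base_colE j : b j 0 = (lift ord0 j == i)%:R - (ord0 == i)%:R.
Proof. by rewrite !mxE ![i == _]eq_sym. Qed.

Lemma dist_star_const l y a c : (forall k, y k 0 = l * (i \in endpoints k)%:R) ->
  dist y a c = l * ((a == i)%:R + (c == i)%:R - 2 * (a == i)%:R * (c == i)%:R).
Proof.
move=> yE; have [<-|nac] := eqVneq a c.
  by rewrite dist_diag; case: (a == i) => /=; ring.
have [k Ek] := edge_exists nac; rewrite (dist_edge _ Ek) yE Ek !inE.
rewrite ![i == _]eq_sym; have [ai|_] := eqVneq a i; have [ci|_] := eqVneq c i => /=.
- by rewrite ai ci eqxx in nac.
- by ring.
- by ring.
- by ring.
Qed.

(** The squared lengths of a star come from the configuration in which all the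
    vertices but i coincide, hence a Gram matrix of rank one. *)
Lemma gram_star_const l y : (forall k, y k 0 = l * (i \in endpoints k)%:R) ->
  gram y = (2 * l) *: (b *m b^T).
Proof.
move=> yE; apply/matrixP=> j k; rewrite gram_entry !(dist_star_const _ _ yE).
rewrite [RHS]mxE [(b *m b^T) j k]mxE big_ord1 [b^T _ _]mxE !base_colE.
by case: (ord0 == i) => /=; ring.
Qed.

(** Moving only the lengths of edges at i changes the Gram form by the product of the
    i-th coordinate with a linear form. *)
Lemma gram_star_support y : (forall k, i \notin endpoints k -> y k 0 = 0) ->
  let z := - (base_mx C m *m col i (dist y)) in gram y = b *m z^T + z *m b^T.
Proof.
move=> y0 z; rewrite /z.
have -> : gram y = - (base_mx C m *m (delta_mx i 0 *m (col i (dist y))^T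
     + col i (dist y) *m delta_mx 0 i) *m (base_mx C m)^T).
  rewrite /gram; congr (- (_ *m _ *m _)); apply/matrixP=> a c.
  rewrite [RHS]mxE [X in _ = X + _]mxE [X in _ = _ + X]mxE !big_ord1.
  rewrite [delta_mx _ _ _ _]mxE [delta_mx _ _ _ _]mxE ![(col i _)^T _ _]mxE ![col i _ _ _]mxE eqxx andbT /=.
  have [->|nai] := eqVneq a i.
    have [->|nci] := eqVneq c i; first by rewrite dist_diag mul1r mulr1 addr0.
    by rewrite mul1r mulr0 addr0 distC.
  rewrite mul0r add0r; have [->|nci] := eqVneq c i; first by rewrite mulr1.
  rewrite mulr0; have [->|nac] := eqVneq a c; first by rewrite dist_diag.
  have [k Ek] := edge_exists nac; rewrite (dist_edge _ Ek) y0 // Ek !inE negb_or.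
  by rewrite ![i == _]eq_sym nai nci.
rewrite mulmxDr mulmxDl opprD linearN /= trmx_mul mulmxN mulNmx !colE !mulmxA.
by rewrite [(base_mx C m *m delta_mx i 0)^T]trmx_mul trmx_delta !mulmxA.
Qed.
End StarGram.

(** When the entry (j, k) vanishes to order a j + b k at least, its quotient by that
    power of 'X is a polynomial matrix whose value at 0 reads off A0, A1 or A2
    according to the weight of the entry. *)
Lemma graded_entries (R : comNzRingType) n (A0 A1 A2 : 'M[R]_n) (Z : 'M[{poly R}]_n)
    (a b : 'I_n -> nat) :
  (forall j k, (a j + b k <= 2)%N) ->
  (forall j k, (0 < a j + b k)%N -> A0 j k = 0) ->
  (forall j k, (1 < a j + b k)%N -> A1 j k = 0) ->
  exists2 V : 'M[{poly R}]_n,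
    forall j k, (mxC A0 + 'X *: mxC A1 + 'X^2 *: mxC A2 + 'X^3 *: Z) j k
      = V j k * 'X^(a j + b k) &
    forall j k, (V j k).[0] = [:: A0 j k; A1 j k; A2 j k]`_(a j + b k).
Proof.
move=> le2 A00 A10; pose V := \matrix_(j, k)
  [:: (A0 j k)%:P + 'X * (A1 j k)%:P + 'X^2 * (A2 j k)%:P + 'X^3 * Z j k;
      (A1 j k)%:P + 'X * (A2 j k)%:P + 'X^2 * Z j k;
      (A2 j k)%:P + 'X * Z j k]`_(a j + b k).
exists V => j k; rewrite [V j k]mxE.
  rewrite !mxE; have := A00 j k; have := A10 j k; have := le2 j k.
  case: (a j + b k)%N => [|[|[|//]]] _ A1E A0E /=.
  - by ring.
  - by rewrite A0E // polyC0; ring.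
  - by rewrite A0E // A1E // polyC0; ring.
have := le2 j k; case: (a j + b k)%N => [|[|[|//]]] _ /=;
  by rewrite !hornerE /= ?expr0n /= ?(mul0r, addr0).
Qed.

Lemma sum_ord_gt0 n : (\sum_(j < n.+1) (0 < j) = n)%N.
Proof. by rewrite big_ord_recl /= add0n sum1_card card_ord. Qed.

(** In a basis whose first vector is the rank one direction b, the Gram matrix along
    any line through a star has order 2 outside the first row and column, and order
    1 on their off-diagonal entries. Weight 1 on each of the d other indices, for
    rows and for columns, gives order d + d. *)
Lemma mult_of_star (C : numClosedFieldType) d i (w : 'cV[C]_(nedges d.+2)) :
  star i w -> has_mult (d + d) w.
Proof.
move=> [l nzl wE] u; rewrite /cmdet gram_quadratic.
have -> : gram (sqv w) = (2 * l) *: (col i (base_mx C d.+1) *m (col i (base_mx C d.+1))^T).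
  by apply: gram_star_const => k; rewrite mxE wE.
rewrite (@gram_star_support C d.+1 i (\col_k (2 * w k 0 * u k 0))) => [|k nk]; last first.
  have /eqP := wE k; rewrite (negPf nk) mulr0 expf_eq0 /= mxE => /eqP->.
  by rewrite mulr0 mul0r.
move: (col i (base_mx _ _)) (- _) (gram (sqv u)) => b z G2.
have [U uU [c Ub]] := col_reduce b.
rewrite -(@dvdpZr _ ((\det U)^+2)) ?expf_neq0 -?unitfE -?unitmxE //.
rewrite -mul_polyC rmorphXn /= -det_map_mx expr2 mulrAC -{2}det_tr -!det_mulmx.
rewrite !mulmxDr !mulmxDl -!scalemxAr -!scalemxAl map_trmx -!map_mxM.
have conjE (y1 y2 : 'cV[C]_d.+1) : U *m (y1 *m y2^T) *m U^T = (U *m y1) *m (U *m y2)^T.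
  by rewrite trmx_mul !mulmxA.
set A0 := U *m _ *m _; set A1 := U *m _ *m _; set A2 := U *m _ *m _.
pose a (j : 'I_d.+1) : nat := (0 < j)%N.
have [j k|j k|j k|V EV _] := @graded_entries C _ A0 A1 A2 0 a a.
- by rewrite /a; case: (0 < j)%N; case: (0 < k)%N.
- move=> n0; rewrite /A0 -!scalemxAr -!scalemxAl conjE Ub.
  rewrite linearZ /= -scalemxAl -scalemxAr trmx_delta mul_delta_mx !mxE.
  move: n0; rewrite /a !lt0n -!(inj_eq val_inj) /=.
  by case: (j == 0 :> nat); case: (k == 0 :> nat) => //= _; rewrite !mulr0.
- move=> n0; have /andP[nj nk] : (j != 0) && (k != 0).
    by move: n0; rewrite /a !lt0n -!(inj_eq val_inj) /=; do 2!case: eqP.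
  rewrite /A1 mulmxDr mulmxDl !conjE Ub mxE; move: (U *m z) => z'.
  rewrite [X in X + _]mxE [X in _ + X]mxE !big_ord1 !mxE.
  by rewrite (negPf nj) (negPf nk) /= !(mulr0, mul0r) addr0.
move: EV; rewrite scaler0 addr0 => /det_rescale->.
by rewrite sum_ord_gt0 dvdp_mull.
Qed.

(** * Points of high multiplicity are stars *)

Lemma horner_eq0_poly (F : numFieldType) (p : {poly F}) : (forall x, p.[x] = 0) -> p = 0.
Proof.
move=> p0; apply: (@roots_geq_poly_eq0 _ _ [seq n%:R | n <- iota 0 (size p)]).
- by apply/allP=> x _; rewrite rootE p0.
- rewrite map_inj_uniq ?iota_uniq // => a b /eqP.
  by rewrite eqr_nat => /eqP.
- by rewrite size_map size_iota.
Qed.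

(** Vanishing to order q along lines gives vanishing along polynomial arcs: the
    coefficients of cmdet (w + 'Y * u) in 'Y below q are polynomials in the
    coordinates of u, zero at every specialization, and one may then put 'Y := 'X. *)
Lemma has_mult_poly (C : numClosedFieldType) m q (w : 'cV[C]_(nedges m.+1))
    (u : 'cV[{poly C}]_(nedges m.+1)) :
  has_mult q w -> 'X^q %| cmdet (mxC w + 'X *: u).
Proof.
move=> mw.
pose P : {poly {poly C}} := cmdet (mxC (mxC w) + 'X *: mxC u).
have PE (x : C) : map_poly (horner_eval x) P =
    cmdet (mxC w + 'X *: mxC (map_mx (horner_eval x) u)).
  rewrite -(cmdet_map (map_poly (horner_eval x))); congr cmdet.
  apply/matrixP=> k c; rewrite !mxE rmorphD rmorphM /= map_polyX !map_polyC /=.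
  by rewrite /horner_eval hornerC.
have P0 j : (j < q)%N -> P`_j = 0.
  move=> ltjq; apply: horner_eq0_poly => x.
  have <- : (map_poly (horner_eval x) P)`_j = (P`_j).[x] by rewrite coef_map.
  by rewrite PE; have /dvdpP[r ->] := mw (map_mx (horner_eval x) u); rewrite coefMXn ltjq.
have -> : cmdet (mxC w + 'X *: u) = P.['X].
  rewrite -[P.['X]]/(horner_eval 'X P) /P -cmdet_map; congr cmdet.
  by apply/matrixP=> k c; rewrite !mxE /= /horner_eval !hornerE.
rewrite -(poly_take_drop q P).
have -> : take_poly q P = 0.
  by apply/polyP=> j; rewrite coef_take_poly coef0; case: ifP => // /P0.
by rewrite add0r hornerM hornerXn dvdp_mull.
Qed.

(** An arc x(s) through w for which the squares of the coordinates have arbitrary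
    second order terms, and first order terms t on the edges where w is nonzero.
    Where w_k vanishes the arc is s * sqrt c_k; elsewhere the coefficients of
    (w_k + a s + b s^2)^2 = w_k^2 + t_k s + c_k s^2 + O(s^3) are solved for a, b. *)
Lemma mult_second_order (C : numClosedFieldType) m q (w t : 'cV[C]_(nedges m.+1))
    (Q : 'M[C]_m) :
  has_mult q w -> (forall k, w k 0 = 0 -> t k 0 = 0) -> Q^T = Q ->
  exists Z : 'M[{poly C}]_m, 'X^q %| \det (mxC (gram (sqv w)) + 'X *: mxC (gram t)
     + 'X^2 *: mxC Q + 'X^3 *: Z).
Proof.
move=> mw t0 symQ; pose c := ungram Q.
pose a : 'cV[C]_(nedges m.+1) := \col_k (t k 0 / (2 * w k 0)).
pose b : 'cV[C]_(nedges m.+1) := \col_k ((c k 0 - a k 0 ^+ 2) / (2 * w k 0)).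
pose u : 'cV[{poly C}]_(nedges m.+1) := \col_k
  if w k 0 == 0 then (sqrtC (c k 0))%:P else (a k 0)%:P + 'X * (b k 0)%:P.
pose z : 'cV[{poly C}]_(nedges m.+1) := \col_k
  if w k 0 == 0 then 0 else 2 * (a k 0)%:P * (b k 0)%:P + 'X * (b k 0)%:P ^+ 2.
exists (gram z); have := has_mult_poly u mw; rewrite /cmdet.
suff -> : sqv (mxC w + 'X *: u) = mxC (sqv w) + 'X *: mxC t + 'X^2 *: mxC c + 'X^3 *: z.
  by rewrite !gramD !gramZ !gram_map gram_ungram.
apply/matrixP=> k e; rewrite {e}ord1.
have -> : sqv (mxC w + 'X *: u) k 0 = ((w k 0)%:P + 'X * u k 0) ^+ 2 by rewrite 4!mxE.
have -> : (mxC (sqv w) + 'X *: mxC t + 'X^2 *: mxC c + 'X^3 *: z) k 0 =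
    (w k 0)%:P ^+ 2 + 'X * (t k 0)%:P + 'X^2 * (c k 0)%:P + 'X^3 * z k 0.
  by clearbody u z; clearbody c; rewrite !mxE rmorphXn.
rewrite [u k 0]mxE [z k 0]mxE.
have [wk0|nzw] := eqVneq (w k 0) 0.
  by rewrite (t0 _ wk0) wk0 -[in RHS](sqrtCK (c k 0)) rmorphXn /= polyC0; ring.
have tE : (t k 0)%:P = 2 * (w k 0)%:P * (a k 0)%:P.
  by rewrite -polyC_natr -!polyCM; congr _%:P; rewrite [a k 0]mxE; field.
have cE : (c k 0)%:P = (a k 0)%:P ^+ 2 + 2 * (w k 0)%:P * (b k 0)%:P.
  rewrite -polyC_natr -polyC_exp -!polyCM -polyCD; congr _%:P.
  by rewrite [b k 0]mxE; field.
rewrite tE cE; ring.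
Qed.

Lemma congr_line (R : comNzRingType) n (P A0 A1 A2 : 'M[R]_n) (Z : 'M[{poly R}]_n) :
  mxC P *m (mxC A0 + 'X *: mxC A1 + 'X^2 *: mxC A2 + 'X^3 *: Z) *m mxC P^T
  = mxC (P *m A0 *m P^T) + 'X *: mxC (P *m A1 *m P^T) + 'X^2 *: mxC (P *m A2 *m P^T)
   + 'X^3 *: (mxC P *m Z *m mxC P^T).
Proof. by rewrite !mulmxDr !mulmxDl -!scalemxAr -!scalemxAl -!map_mxM. Qed.

(** A lower bound on the vanishing order of the determinant is contradicted as soon as
    some weights have a small sum and a nonsingular leading part. *)
Lemma graded_order (F : fieldType) n (P A0 A1 A2 : 'M[F]_n) (Z : 'M[{poly F}]_n)
    (a b : 'I_n -> nat) q : P \in unitmx ->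
  'X^q %| \det (mxC (P *m A0 *m P^T) + 'X *: mxC (P *m A1 *m P^T)
    + 'X^2 *: mxC (P *m A2 *m P^T) + 'X^3 *: Z) ->
  (forall j k, (a j + b k <= 2)%N) ->
  (forall j k, (0 < a j + b k)%N -> A0 j k = 0) ->
  (forall j k, (1 < a j + b k)%N -> A1 j k = 0) ->
  \det (\matrix_(j, k) [:: A0 j k; A1 j k; A2 j k]`_(a j + b k)) != 0 ->
  (q <= \sum_j a j + \sum_j b j)%N.
Proof.
move=> uP dvd le2 A00 A10 nzdet.
have uPC : mxC P \in unitmx by rewrite map_unitmx.
pose Z' := invmx (mxC P) *m Z *m invmx (mxC P^T).
have EZ : Z = mxC P *m Z' *m mxC P^T.
  rewrite /Z' !mulmxA mulmxV // mul1mx -mulmxA mulVmx ?mulmx1 //.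
  by rewrite map_unitmx unitmx_tr.
move: dvd; rewrite EZ -congr_line !det_mulmx !det_map_mx det_tr mulrAC -rmorphM /=.
have [V EV V0] := graded_entries A2 Z' le2 A00 A10.
rewrite mul_polyC dvdpZr; last first.
  by rewrite mulf_neq0 // -unitfE -unitmxE.
apply: det_order EV _.
suff -> : map_mx (horner_eval 0) V = \matrix_(j, k) [:: A0 j k; A1 j k; A2 j k]`_(a j + b k) by [].
by apply/matrixP=> j k; rewrite [LHS]mxE [RHS]mxE -V0.
Qed.

Lemma sum_ord_ge r n : (r <= n)%N -> (\sum_(j < n) (r <= j) = n - r)%N.
Proof.
elim: n => [|n IHn]; first by rewrite big_ord0.
rewrite leq_eqVlt => /orP[/eqP->|le_rn].
  by rewrite subnn big1 // => j _; rewrite leqNgt ltn_ord.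
have {}le_rn : (r <= n)%N := le_rn.
by rewrite big_ord_recr /= IHn // le_rn addn1 subSn.
Qed.

(** If G = gram (w^2) has rank r, choose an arc whose second order term is the
    complementary partial identity in the basis where G is pid_mx r. The determinant
    then has order exactly 2 (d + 1 - r), so order 2 d forces r <= 1. *)
Lemma mult_gram_rank (C : numClosedFieldType) d (w : 'cV[C]_(nedges d.+2)) :
  has_mult (d + d) w -> exists2 P, P \in unitmx &
    exists2 r, (r <= 1)%N & gram (sqv w) = P *m pid_mx r *m P^T.
Proof.
move=> mw; have [P uP [r ler EG]] := sym_normal_form (gram_tr (sqv w)).
exists P => //; exists r => //.
(* The second order term fills the kernel of the Gram matrix. *)
have symQ : (P *m copid_mx r *m P^T)^T = P *m copid_mx r *m P^T.
  by rewrite !trmx_mul trmxK /copid_mx linearB /= tr_pid_mx trmx1 mulmxA.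
have [k _|Z] := mult_second_order (t := 0) mw _ symQ; first by rewrite mxE.
have -> : gram (0 : 'cV[C]_(nedges d.+2)) = P *m 0 *m P^T.
  by rewrite -(scale0r (0 : 'cV_ _)) gramZ scale0r mulmx0 mul0mx.
rewrite EG => /(graded_order uP (a := fun j => (r <= j)%N) (b := fun j => (r <= j)%N)) H.
have : (d + d <= \sum_(j < d.+1) (r <= j) + \sum_(j < d.+1) (r <= j))%N.
  apply: H.
  - by move=> j k; case: (r <= j)%N; case: (r <= k)%N.
  - move=> j k n0; rewrite !mxE; case: (j =P k :> nat) n0 => [->|//].
    by case: (leqP r k).
  - by move=> j k _; rewrite mxE.
  - set W := (X in \det X); suff -> : W = 1%:M by rewrite det1 oner_neq0.
    apply/matrixP=> j k; rewrite !mxE -(inj_eq val_inj) /=.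
    have [->|njk] := eqVneq (j : nat) k.
      by case: (leqP r k) => //= _; rewrite ?subr0.
    by rewrite /= subrr; case: (r <= j)%N; case: (r <= k)%N.
rewrite sum_ord_ge //; lia.
Qed.

(** With G = pid_mx 1, suppose that a first order deformation E of G induces a form of
    rank r on the kernel of G. Completed by a second order term K, it makes the
    determinant vanish to order r + 2 (d - r) only. The weights are those of the three
    blocks: the image of G (row 0, column 0), the image of the induced form (row 0,
    column 1), the rest (row 1, column 1). The rank one part of K cancels the coupling
    of the kernel with the first vector, which contributes at the same order. *)
Lemma mult_tangent_rank (C : numClosedFieldType) d (w t : 'cV[C]_(nedges d.+2))
    (P : 'M_(1 + d)) (E : 'M_(1 + d)) r :
  has_mult (d + d) w -> (forall k, w k 0 = 0 -> t k 0 = 0) ->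
  P \in unitmx -> gram (sqv w) = P *m pid_mx 1 *m P^T -> gram t = P *m E *m P^T ->
  (r <= d)%N -> drsubmx E = pid_mx r -> E^T = E -> r = 0%N.
Proof.
move=> mw t0 uP EG Et ler Edr symE.
pose e : 'rV[C]_d := ursubmx E.
(* e couples the first vector with the kernel; e^T e compensates its Schur complement. *)
pose K : 'M_(1 + d) := block_mx 0 0 0 (copid_mx r + e^T *m e).
have symK : K^T = K.
  rewrite /K tr_block_mx !trmx0; congr block_mx.
  by rewrite linearD /= trmx_mul trmxK /copid_mx linearB /= tr_pid_mx trmx1.
have symQ : (P *m K *m P^T)^T = P *m K *m P^T.
  by rewrite !trmx_mul trmxK symK mulmxA.
have [Z] := mult_second_order mw t0 symQ.
rewrite EG Et => /(graded_order uP (a := fun j => (r < j)%N) (b := fun j => (0 < j)%N)) H.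
have : (d + d <= \sum_(j < d.+1) (r < j) + \sum_(j < d.+1) (0 < j))%N.
  have EE (j k : 'I_d) : E (rshift 1 j) (rshift 1 k) = ((j == k) && (j < r)%N)%:R.
    by have /matrixP/(_ j k) := Edr; rewrite !mxE.
  have rS (j : 'I_d) : (r < rshift 1 j)%N = (r <= j)%N by [].
  have gt0S (j : 'I_d) : (0 < rshift 1 j)%N by [].
  have gt00 : (0 < lshift d (ord0 : 'I_1))%N = false by [].
  apply: H.
  - by move=> j k; case: (r < j)%N; case: (0 < k)%N.
  - move=> j k n0; rewrite mxE; case: (j =P k :> nat) n0 => [->|//].
    by case: (nat_of_ord k) => [|k'] //= _; rewrite andbF.
  - move=> j k n0.
    case: (splitP j) n0 => [j'|j'] ej; first by rewrite ej ord1 ltn0; case: (0 < k)%N.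
    case: (splitP k) => [k'|k'] ek; first by rewrite ek ord1 ltn0 addn0; case: (r < j)%N.
    have -> : j = rshift 1 j' by apply: val_inj.
    have -> : k = rshift 1 k' by apply: val_inj.
    by rewrite EE /= add1n ltnS; case: (leqP r j'); rewrite ?andbF.
  - pose l : 'cV[C]_d := \col_j (if (r <= j)%N then e 0 j else 0).
    set W := (X in \det X).
    suff -> : W = block_mx 1%:M 0 l 1%:M *m block_mx 1%:M e 0 1%:M :> 'M[C]_(1 + d).
      by rewrite det_mulmx det_lblock det_ublock !det1 !mulr1 oner_neq0.
    rewrite mulmx_block !(mul1mx, mulmx1, mulmx0, mul0mx, addr0, add0r).
    apply/matrixP=> j k; rewrite [LHS]mxE.
    case: (splitP j) => [j'|j'] ej; case: (splitP k) => [k'|k'] ek.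
    + have -> : j = lshift d j' by apply: val_inj.
      have -> : k = lshift d k' by apply: val_inj.
      by rewrite [RHS]block_mxEul !ord1 /= !mxE.
    + have -> : j = lshift d j' by apply: val_inj.
      have -> : k = rshift 1 k' by apply: val_inj.
      by rewrite [RHS]block_mxEur !ord1 /= !mxE.
    + have -> : j = rshift 1 j' by apply: val_inj.
      have -> : k = lshift d k' by apply: val_inj.
      rewrite [RHS]block_mxEdl !ord1 rS gt00 addn0 [l _ _]mxE; case: (leqP r j') => _.
        by rewrite [RHS]mxE [RHS]mxE /= -[in LHS]symE mxE.
      by rewrite [LHS]mxE.
    + have -> : j = rshift 1 j' by apply: val_inj.
      have -> : k = rshift 1 k' by apply: val_inj.
      rewrite [RHS]block_mxEdr rS gt0S addn1 [K _ _]block_mxEdr EE.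
      rewrite [RHS]mxE [(copid_mx _ + _) _ _]mxE ![(_ *m e) _ _]mxE !big_ord1.
      rewrite [l _ _]mxE [e^T _ _]mxE [copid_mx _ _ _]mxE [(- pid_mx _) _ _]mxE ![1%:M _ _]mxE [pid_mx r _ _]mxE.
      case: (leqP r j') => _ /=; first by rewrite andbF subr0 addrC.
      by rewrite mul0r add0r andbT.
rewrite sum_ord_gt0; have -> : (\sum_(j < d.+1) (r < j) = d - r)%N by rewrite sum_ord_ge.
lia.
Qed.

(** Puts the induced form in normal form by a change of basis of the kernel of G. *)
Lemma mult_tangent_zero (C : numClosedFieldType) d (w t : 'cV[C]_(nedges d.+2))
    (P E : 'M_(1 + d)) :
  has_mult (d + d) w -> (forall k, w k 0 = 0 -> t k 0 = 0) ->
  P \in unitmx -> gram (sqv w) = P *m pid_mx 1 *m P^T -> gram t = P *m E *m P^T ->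
  E^T = E -> drsubmx E = 0.
Proof.
move=> mw t0 uP EG Et symE.
have symD : (drsubmx E)^T = drsubmx E by rewrite trmx_drsub symE.
have [P' uP' [r ler ED]] := sym_normal_form symD.
suff r0 : r = 0%N by rewrite ED r0 pid_mx_0 mulmx0 mul0mx.
pose B : 'M_(1 + d) := block_mx 1%:M 0 0 P'.
pose B' : 'M_(1 + d) := block_mx 1%:M 0 0 (invmx P').
have BK : B *m B' = 1%:M.
  rewrite mulmx_block !(mul1mx, mulmx0, mul0mx, addr0, add0r) mulmxV //.
  by rewrite -scalar_mx_block.
have uB : B \in unitmx by have [] := mulmx1_unit BK.
have Bpid : B *m pid_mx 1 *m B^T = pid_mx 1.
  have -> : pid_mx 1 = block_mx 1%:M 0 0 0 :> 'M[C]_(1 + d).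
    rewrite -[LHS]submxK; congr block_mx; apply/matrixP=> i j; rewrite !mxE //=.
    - by rewrite !ord1.
    - by rewrite ord1.
    - by rewrite ord1.
    - by rewrite andbF.
  by rewrite /B congr_diag_block trmx1 mulmx1 mulmx0 mul0mx.
apply: (@mult_tangent_rank _ _ w t (P *m B) (B' *m E *m B'^T) r mw t0) => //.
- by rewrite unitmx_mul uP.
- by rewrite EG trmx_mul -{1}Bpid !mulmxA.
- rewrite Et trmx_mul -!mulmxA; congr (_ *m _); rewrite !mulmxA BK mul1mx.
  by rewrite -!mulmxA; congr (_ *m _); rewrite mulmxA -trmx_mul BK trmx1 mul1mx.
- rewrite -[E]submxK tr_block_mx !mulmx_block block_mxKdr.
  rewrite !(mul0mx, trmx0, mulmx0, add0r, addr0) ED !mulmxA mulVmx // mul1mx.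
  by rewrite -mulmxA -trmx_mul mulVmx // trmx1 mulmx1.
- by rewrite !trmx_mul trmxK symE mulmxA.
Qed.

Lemma gram_delta (C : numClosedFieldType) m (k : 'I_(nedges m.+1)) i j :
  i != j -> endpoints k = [set i; j]%SET ->
  gram (delta_mx k 0 : 'cV[C]__) = - (col i (base_mx C m) *m (col j (base_mx C m))^T
    + col j (base_mx C m) *m (col i (base_mx C m))^T).
Proof.
move=> nij Ek; rewrite (@gram_star_support C m i (delta_mx k 0)) => [|h nih]; last first.
  rewrite mxE andbT; case: eqP nih => // ->.
  by rewrite Ek !inE eqxx.
have -> : col i (dist (delta_mx k 0)) = delta_mx j 0 :> 'cV[C]_m.+1.
  apply/matrixP=> a c; rewrite ord1 [LHS]mxE [RHS]mxE andbT.
  have [->|nai] := eqVneq a i; first by rewrite dist_diag (negPf nij).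
  have [h Eh] := edge_exists nai; rewrite (dist_edge _ Eh) mxE andbT.
  congr ((nat_of_bool _)%:R); apply/eqP/eqP => [hk|aj].
    have : a \in endpoints k by rewrite -hk Eh !inE eqxx.
    by rewrite Ek !inE (negPf nai) => /eqP.
  by apply: endpoints_inj; rewrite Eh Ek aj finset.setUC.
by rewrite -colE linearN /= mulmxN mulNmx opprD.
Qed.

(** A product of two linear forms vanishes identically only if one of them does. *)
Lemma sym_rank2_zero (C : numClosedFieldType) n (x y : 'I_n -> C) :
  (forall j k, x j * y k + y j * x k = 0) ->
  (forall j, x j = 0) \/ (forall j, y j = 0).
Proof.
move=> xy0; case: (pickP (fun j => x j != 0)) => [j nzx|x0]; last first.
  by left=> j; apply/eqP/negbFE; apply: x0.
right=> k; have yj : y j = 0.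
  have /eqP := xy0 j j; rewrite [y j * _]mulrC -mulr2n mulrn_eq0 /= mulf_eq0.
  by rewrite (negPf nzx) => /eqP.
by have /eqP := xy0 j k; rewrite yj mul0r addr0 mulf_eq0 (negPf nzx) => /eqP.
Qed.

Lemma base_col_neq0 (C : numClosedFieldType) d (i : 'I_d.+2) :
  col i (base_mx C d.+1) != 0.
Proof.
apply/eqP=> /matrixP b0; case: (unliftP ord0 i) b0 => [j|] -> b0.
  have := b0 j 0; rewrite base_colE mxE eqxx subr0 => /eqP; by rewrite oner_eq0.
have := b0 ord0 0; rewrite base_colE mxE eqxx sub0r => /eqP.
by rewrite oppr_eq0 oner_eq0.
Qed.

(** If the i-th coordinate spans the image of the rank one Gram matrix, then all the
    other vertices coincide in the collinear configuration that w measures. *)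
Lemma star_of_gram (C : numClosedFieldType) d (w : 'cV[C]_(nedges d.+2)) i (c : C)
    (y : 'cV_d.+1) : col i (base_mx C d.+1) = c *: y -> gram (sqv w) = y *m y^T ->
  star i w.
Proof.
move=> Ey EG; have nzc : c != 0.
  by apply: contraNneq (base_col_neq0 C i) => c0; rewrite Ey c0 scale0r.
exists (c ^- 2 / 2); first by rewrite !mulf_neq0 ?invr_eq0 ?expf_neq0 ?pnatr_eq0.
pose y0 : 'cV[C]_(nedges d.+2) := \col_k (c ^- 2 / 2 * (i \in endpoints k)%:R).
suff Ew : sqv w = y0 by move=> k; have /matrixP/(_ k 0) := Ew; rewrite !mxE.
apply: gram_inj; rewrite (@gram_star_const _ _ i (c ^- 2 / 2) y0); last by move=> k; rewrite mxE.
rewrite EG Ey linearZ /= -scalemxAl -scalemxAr !scalerA.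
suff -> : 2 * (c ^- 2 / 2) * c * c = 1 by rewrite scale1r.
by field; rewrite nzc.
Qed.

(** Rank at most one means that w measures a collinear configuration. Choose an edge ij
    with w_ij <> 0. The deformation of that edge alone is the product of the i-th and
    j-th coordinates; it has to vanish on the kernel of G, so one of the two coordinates
    is zero on the kernel, that is, proportional to the linear form defining it. *)
Theorem star_of_mult (C : numClosedFieldType) d (w : 'cV[C]_(nedges d.+2)) :
  w != 0 -> has_mult (d + d) w -> exists i, star i w.
Proof.
move=> nzw mw; have [P uP [r ler EG]] := mult_gram_rank mw.
case: (pickP (fun k => w k 0 != 0)) => [k0 nzk|w0]; last first.
  case/eqP: nzw; apply/matrixP=> k c; rewrite ord1 mxE.
  by apply/eqP/negbFE; apply: w0.
move: ler; rewrite leq_eqVlt ltnS leqn0 => /orP[] /eqP er; rewrite er in EG; last first.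
  move: EG; rewrite pid_mx_0 mulmx0 mul0mx -(scale0r (gram (sqv w))) -gramZ.
  move/gram_inj/matrixP/(_ k0 0)/eqP; rewrite mxE scale0r mxE expf_eq0 /=.
  by rewrite (negPf nzk).
pose i := src k0; pose j := tgt k0.
pose x := invmx P *m col i (base_mx C d.+1).
pose y := invmx P *m col j (base_mx C d.+1).
pose E : 'M_(1 + d) := - (x *m y^T + y *m x^T).
have EE : gram (delta_mx k0 0 : 'cV[C]__) = P *m E *m P^T.
  rewrite (@gram_delta _ _ _ i j) ?src_neq_tgt // /E mulmxN mulNmx.
  have cancelP (u v : 'cV[C]_d.+1) :
      P *m (invmx P *m u *m (invmx P *m v)^T) *m P^T = u *m v^T.
    by rewrite -!mulmxA mulKVmx // -trmx_mul mulKVmx.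
  by rewrite mulmxDr mulmxDl !cancelP.
have symE : E^T = E by rewrite /E linearN linearD /= !trmx_mul !trmxK addrC.
have t0 k : w k 0 = 0 -> (delta_mx k0 0 : 'cV[C]_(nedges d.+2)) k 0 = 0.
  by rewrite mxE andbT; case: eqP => // -> w0; rewrite w0 eqxx in nzk.
have E0 := mult_tangent_zero mw t0 uP EG EE symE.
pose e0 : 'cV[C]_(1 + d) := delta_mx 0 0.
have pidE : pid_mx 1 = e0 *m e0^T.
  rewrite /e0 trmx_delta mul_delta_mx; apply/matrixP=> a b; rewrite !mxE -!(inj_eq val_inj) /=.
  by case: a b => [[|a] Ha] [[|b] Hb]; rewrite //= ?andbF.
have EG' : gram (sqv w) = (P *m e0) *m (P *m e0)^T.
  by rewrite EG pidE trmx_mul !mulmxA.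
have star_of_col v (l : 'I_d.+2) : v = invmx P *m col l (base_mx C d.+1) ->
    (forall a : 'I_d, v (rshift 1 a) 0 = 0) -> exists l', star l' w.
  move=> Ev v0; exists l; apply: (star_of_gram (c := v 0 0) _ EG').
  rewrite scalemxAr; have -> : v 0 0 *: e0 = v.
    apply/matrixP=> a c; rewrite ord1 !mxE andbT.
    case: (splitP (a : 'I_(1 + d))) => a' ea.
      have -> : a = 0 by apply: val_inj; rewrite /= ea ord1.
      by rewrite eqxx mulr1.
    have -> : a = rshift 1 a' by apply: val_inj.
    by rewrite v0 -(inj_eq val_inj) /= mulr0.
  by rewrite Ev mulKVmx.
have [|x0|y0] := @sym_rank2_zero C d (fun a => x (rshift 1 a) 0) (fun a => y (rshift 1 a) 0).
- move=> a b; have /matrixP/(_ a b) := E0.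
  rewrite [LHS]mxE [LHS]mxE [RHS]mxE [LHS]mxE [X in - X]mxE.
  rewrite [X in - (X + _)]mxE [X in - (_ + X)]mxE !big_ord1 ![_^T _ _]mxE.
  by move/eqP; rewrite oppr_eq0 => /eqP.
- exact: star_of_col x0.
- exact: star_of_col y0.
Qed.

(** * A line with simple roots *)

Section Pencil.
Variable C : numClosedFieldType.

(** Gram matrices along lines on which the lengths of the edges at vertex 0 are
    constant (with squares s) and the other lengths vary affinely. The diagonal entries
    2 s_i fit the same formula, with a zero length. *)
Definition pencil k (W : 'M[{poly C}]_k) (s : 'I_k -> C)  :=
  W^T = W /\ forall i j, exists g h, (i = j -> g = 0 /\ h = 0) /\
    W i j = (s i + s j)%:P - (g%:P + h%:P * 'X) ^+ 2.

(** The size condition says that the degree of [cmdet] does not drop on the line, the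
    last one that scaling the parameter moves every root. *)
Definition simple_pencil k := exists W : 'M[{poly C}]_k, exists2 s, pencil W s &
  [/\ separable_poly (\det W), size (\det W) = (k + k).+1 & (\det W).[0] != 0].

Lemma simple_pencil0 : simple_pencil 0.
Proof.
exists 1%:M; exists (fun=> 0); first by split; [apply/matrixP; case | case].
by rewrite det1 size_poly1 hornerC oner_neq0 unlock coprime1p.
Qed.

Lemma cube_root_exists : exists w : C, w ^+ 2 = - 1 - w.
Proof.
exists ((sqrtC (- 3) - 1) / 2).
by rewrite expr_div_n sqrrB sqrtCK; field.
Qed.

Lemma det_mx33 (R : comNzRingType) (a11 a22 a33 a b c : R) :
  \det (\matrix_(i < 3, j < 3) nth 0 (nth [::] [:: [:: a11; a; b]; [:: a; a22; c]; [:: b; c; a33]] i) j)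
  = a11 * a22 * a33 + 2 * a * b * c - a11 * c ^+ 2 - a22 * b ^+ 2 - a33 * a ^+ 2.
Proof.
rewrite (expand_det_row _ ord0) !big_ord_recl big_ord0 /cofactor.
rewrite !(expand_det_row _ ord0) !big_ord_recl !big_ord0 /cofactor !det_mx11 !mxE /=.
ring.
Qed.

Lemma det_mx22 (R : comNzRingType) (a11 a22 a : R) :
  \det (\matrix_(i < 2, j < 2) nth 0 (nth [::] [:: [:: a11; a]; [:: a; a22]] i) j)
  = a11 * a22 - a ^+ 2.
Proof.
rewrite (expand_det_row _ ord0) !big_ord_recl big_ord0 /cofactor.
rewrite !det_mx11 !mxE /=; ring.
Qed.

(** A tetrahedron with three unit edges at the apex and base edges 1 + w X, 1 + w^2 X
    and 1 + X, w a cube root of unity. The symmetry makes the determinant a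
    quadratic polynomial in 'X^3, with two distinct nonzero roots. *)
Lemma simple_pencil3 : simple_pencil 3.
Proof.
have [w Ew] := cube_root_exists; pose v := - 1 - w.
pose off (h : C) : {poly C} := 2 - (1 + h%:P * 'X) ^+ 2.
pose W := \matrix_(i < 3, j < 3) nth 0 (nth [::]
  [:: [:: 2; off w; off v]; [:: off w; 2; off 1]; [:: off v; off 1; 2]] i) j.
have twoE : 2 = (1 + 1 : C)%:P :> {poly C} by rewrite rmorphD.
have detW : \det W = 4 - 52 * 'X^3 - 2 * 'X^6.
  rewrite det_mx33 /off /v rmorphB rmorphN /= polyC1.
  have /eqP := Ew; rewrite -subr_eq0 => /eqP/(congr1 polyC).
  rewrite !rmorphB rmorphN rmorphXn /= polyC0 polyC1; move: w%:P => p p0.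
  apply/eqP; rewrite -subr_eq0; apply/eqP.
  (* The difference of both sides is w ^ 2 + w + 1 times this quotient. *)
  rewrite -(mul0r (- 20 * 'X^2 + 52 * 'X^3 - 2 * 'X^4 + 2 * 'X^6
    + p * (- 2 * 'X^4 - 4 * 'X^5 - 2 * 'X^6)
    + p ^+ 2 * (- 2 * 'X^4 - 4 * 'X^5 - 2 * 'X^6))) -p0.
  ring.
have offE h : off h = (1 + 1)%:P - (1%:P + h%:P * 'X) ^+ 2 by rewrite -twoE polyC1.
exists W; exists (fun=> 1).
  split; first by apply/matrixP; do 2![case=> [[|[|[|//]]] ?]]; rewrite !mxE.
  have offP h : exists g h' : C, (True -> True) /\ off h = (1 + 1)%:P - (g%:P + h'%:P * 'X) ^+ 2.
    by exists 1, h.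
  have diagP : 2 = (1 + 1)%:P - (0%:P + 0%:P * 'X) ^+ 2 :> {poly C}.
    by rewrite -twoE polyC0 mul0r addr0 expr0n subr0.
  do 2![case=> [[|[|[|//]]] ?]]; rewrite mxE /=;
    try (by exists 0, 0; rewrite -diagP; split);
    by rewrite !offE; eexists _, _; split; [move/(congr1 val)|].
(* The determinant is - 2 (Y ^ 2 + 26 Y - 2) with Y = X ^ 3; complete the square. *)
pose y : {poly C} := 'X^3 + 13%:P; pose q := y ^+ 2 - 171%:P.
have detE : \det W = (- 2) *: q.
  by rewrite detW /q /y -mul_polyC rmorphN !polyC_natr; ring.
have nz2 : - 2 != 0 :> C by rewrite oppr_eq0 pnatr_eq0.
have szq : size q = 7%N.
  have -> : q = 'X^6 + (26 *: 'X^3 - 2%:P).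
    by rewrite /q /y -mul_polyC !polyC_natr; ring.
  rewrite size_polyDl size_polyXn // (leq_ltn_trans (size_polyD _ _)) //.
  rewrite gtn_max size_polyN size_polyC (leq_ltn_trans (size_scale_leq _ _)) ?size_polyXn //.
  by case: (_ != 0).
have q0 : q.[0] = - 2.
  by rewrite /q /y !hornerE /= expr0n /= add0r; ring.
have dq : q^`() = 6 *: ('X^2 * y).
  rewrite /q derivB derivC subr0 deriv_exp /= expr1 /y derivD derivC addr0 derivXn /=.
  by rewrite -mul_polyC polyC_natr; ring.
rewrite detE (eqp_separable (eqp_scale _ nz2)) (size_scale _ nz2) szq hornerZ q0.
split=> //; last by rewrite mulf_neq0.
rewrite unlock dq coprimepZr ?pnatr_eq0 // coprimepMr; apply/andP; split.
  by rewrite coprimep_expr // coprimepX /root q0.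
apply/Bezout_coprimepP; exists (- 1, y) => /=.
have -> : - 1 * q + y * y = 171%:P by rewrite /q; ring.
by rewrite polyC_eqp1 pnatr_eq0.
Qed.

(** Glue, orthogonally at the apex, a triangle with edges 1, 2 at the apex and third
    edge 4 + X / x. The determinants multiply, and by Heron's formula the one of the
    triangle has the roots -x, -3x, -5x, -7x. A generic scale x makes them distinct
    from the roots already present. *)
Lemma simple_pencil_step k : simple_pencil k -> simple_pencil (2 + k).
Proof.
case=> W [s [symW WE] [sepW szW W0]].
(* The common factor 'X in the product below forces the scale x to be nonzero. *)
pose scaled (n : nat) := \det W \Po ((- n%:R)%:P * 'X : {poly C}).
have scaledE n x : (scaled n).[x] = (\det W).[- n%:R * x].
  by rewrite /scaled horner_comp !hornerE.
have scaled_nz n : scaled n != 0.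
  apply: contraNneq W0 => n0; have := scaledE n 0.
  by rewrite n0 horner0 mulr0 => <-.
have [x nzx] : exists x, ('X * (scaled 1 * scaled 3 * scaled 5 * scaled 7)).[x] != 0.
  apply: contrapT => nx.
  have : 'X * (scaled 1 * scaled 3 * scaled 5 * scaled 7) == 0.
    by apply/eqP/horner_eq0_poly => x; apply/eqP; apply: contraT => nz; case: nx; exists x.
  by rewrite !mulf_eq0 polyX_eq0 !(negPf (scaled_nz _)).
move: nzx; rewrite hornerM hornerX !hornerM !scaledE !mulf_eq0 !negb_or.
case/and3P => nx0 /andP[/andP[n1 n3] n5] n7.
pose l : {poly C} := 4%:P + (x^-1)%:P * 'X.
pose V := \matrix_(i < 2, j < 2) nth 0 (nth [::]
  [:: [:: 2%:P; 5%:P - l ^+ 2]; [:: 5%:P - l ^+ 2; 8%:P]] i) j.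
have detV : \det V = (- x^-1 ^+ 4) *: (('X - (- 1 * x)%:P) * ('X - (- 3 * x)%:P)
     * ('X - (- 5 * x)%:P) * ('X - (- 7 * x)%:P)).
  rewrite det_mx22 /l -mul_polyC rmorphN rmorphXn !rmorphM !rmorphN /= !polyC_natr.
  have : (x^-1)%:P * x%:P = 1 by rewrite -polyCM mulVf.
  move: (x^-1)%:P x%:P => y z yz.
  have E n : y * ('X - - n * z) = y * 'X + n.
    by rewrite mulrBr mulNr mulrN opprK mulrCA yz mulr1.
  transitivity (- ((y * ('X - - 1 * z)) * (y * ('X - - 3 * z)) * (y * ('X - - 5 * z))
     * (y * ('X - - 7 * z)))); last by rewrite polyC1; ring.
  by rewrite !E; ring.
have nzx4 : - x^-1 ^+ 4 != 0 by rewrite oppr_eq0 expf_neq0 // invr_eq0.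
exists (block_mx V 0 0 W).
exists (fun j => match split j with inl j => [:: 1; 4]`_j | inr j => s j end).
  have symV : V^T = V.
    by apply/matrixP; do 2![case=> [[|[|//]] ?]]; rewrite !mxE.
  split; first by rewrite tr_block_mx !trmx0 symW symV.
  move=> i j; case: (splitP i) => i' ei; case: (splitP j) => j' ej.
  - have -> : i = lshift k i' by apply: val_inj.
    have -> : j = lshift k j' by apply: val_inj.
    rewrite block_mxEul; case: i' j' {ei ej} => [[|[|//]] Hi] [[|[|//]] Hj]; rewrite mxE /=.
    + exists 0, 0; split=> //; rewrite polyC0 mul0r addr0 expr0n subr0; by congr _%:P; ring.
    + exists 4, x^-1; split; [by move/(congr1 val)|]; by congr (_%:P - _); ring.
    + exists 4, x^-1; split; [by move/(congr1 val)|]; by congr (_%:P - _); ring.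
    + exists 0, 0; split=> //; rewrite polyC0 mul0r addr0 expr0n subr0; by congr _%:P; ring.
  - have -> : i = lshift k i' by apply: val_inj.
    have -> : j = rshift 2 j' by apply: val_inj.
    rewrite block_mxEur mxE; exists (sqrtC ([:: 1; 4]`_i' + s j')), 0; split.
      by move/eqP; rewrite eq_lrshift.
    by rewrite polyC0 mul0r addr0 -polyC_exp sqrtCK subrr.
  - have -> : i = rshift 2 i' by apply: val_inj.
    have -> : j = lshift k j' by apply: val_inj.
    rewrite block_mxEdl mxE; exists (sqrtC (s i' + [:: 1; 4]`_j')), 0; split.
      by move/eqP; rewrite eq_rlshift.
    by rewrite polyC0 mul0r addr0 -polyC_exp sqrtCK subrr.
  - have -> : i = rshift 2 i' by apply: val_inj.
    have -> : j = rshift 2 j' by apply: val_inj.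
    rewrite block_mxEdr; have [g [h [gh0 ->]]] := WE i' j'.
    by exists g, h; split=> // /eqP; rewrite (inj_eq (@rshift_inj _ _)) => /eqP.
have nzW : \det W != 0 by rewrite -size_poly_eq0 szW.
have detE : \det (block_mx V 0 0 W) = (- x^-1 ^+ 4) *: (\det W * ('X - (- 1 * x)%:P)
   * ('X - (- 3 * x)%:P) * ('X - (- 5 * x)%:P) * ('X - (- 7 * x)%:P)).
  by rewrite det_ublock detV -scalerAl; congr (_ *: _); ring.
rewrite detE (eqp_separable (eqp_scale _ nzx4)) (size_scale _ nzx4) hornerZ.
have neq a b : (a != b)%N -> - a%:R * x != - b%:R * x.
  by move=> nab; rewrite (inj_eq (mulIf nx0)) eqr_opp eqr_nat.
split.
- rewrite !separable_root sepW !rootM !root_XsubC /root /= !negb_or.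
  rewrite -[- 1]/(- 1%:R : C) n1 n3 n5 n7 !neq //.
- rewrite !size_Mmonic ?monicXsubC ?mulf_neq0 ?polyXsubC_eq0 // !size_XsubC szW; lia.
- rewrite !hornerM !hornerXsubC !mulf_neq0 // sub0r oppr_eq0 mulf_neq0 //;
  by rewrite oppr_eq0 ?oner_eq0 ?pnatr_eq0.
Qed.

Lemma simple_pencil_exists k : k != 1%N -> simple_pencil k.
Proof.
elim/ltn_ind: k => [[|[|[|[|k]]]]] IH // _.
- exact: simple_pencil0.
- exact: (simple_pencil_step simple_pencil0).
- exact: simple_pencil3.
- exact: (simple_pencil_step (IH _ _ _)).
Qed.
End Pencil.

(** * Automorphisms preserve the determinant up to a constant *)

Lemma coefM_top (R : nzRingType) (p q : {poly R}) a b :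
  (size p <= a.+1)%N -> (size q <= b.+1)%N -> (p * q)`_(a + b) = p`_a * q`_b.
Proof.
move=> sp sq; have lt_a : (a < (a + b).+1)%N by rewrite ltnS leq_addr.
rewrite coefM (bigD1 (Ordinal lt_a)) //= addKn big1 ?addr0 // => i.
rewrite -(inj_eq val_inj) /= neq_ltn => /orP[lt_ia|lt_ai]; last first.
  by rewrite [p`_i]nth_default ?mul0r // (leq_trans sp).
by rewrite [q`__]nth_default ?mulr0 // (leq_trans sq) // ltn_subRL ltn_add2r.
Qed.

Lemma coef_prod_top (R : comNzRingType) (I : Type) (r : seq I) (F : I -> {poly R}) n :
  (forall i, (size (F i) <= n.+1)%N) ->
  (size (\prod_(i <- r) F i)%R <= (size r * n).+1)%N /\
  (\prod_(i <- r) F i)`_(size r * n) = \prod_(i <- r) (F i)`_n.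
Proof.
move=> sF; elim: r => [|i r [IHs IHc]]; first by rewrite !big_nil size_poly1 coef1.
rewrite !big_cons mulSn; split; last by rewrite coefM_top ?sF // IHc.
by rewrite (leq_trans (size_polyMleq _ _)) // -subn1 leq_subLR add1n -addnS -addSn leq_add ?sF.
Qed.

(** Leibniz expansion: only products of top coefficients contribute to the top
    coefficient of the determinant. *)
Lemma det_coef_top (R : comNzRingType) k n (W : 'M[{poly R}]_k) :
  (forall i j, (size (W i j) <= n.+1)%N) ->
  (size (\det W) <= (k * n).+1)%N /\
  (\det W)`_(k * n) = \det (\matrix_(i, j) (W i j)`_n).
Proof.
move=> sW; have szI : size (index_enum 'I_k) = k by rewrite /index_enum -enumT size_enum_ord.
have P (s : 'S_k) := @coef_prod_top R _ (index_enum 'I_k) (fun i => W i (s i)) n (fun i => sW i (s i)).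
rewrite szI in P; have signE (s : 'S_k) : (-1) ^+ s = ((-1) ^+ s)%:P :> {poly R}.
  by rewrite rmorphXn rmorphN1.
split.
  apply: leq_trans (size_sum _ _ _) _; apply/bigmax_leqP => s _.
  by rewrite signE mul_polyC (leq_trans (size_scale_leq _ _)) //; case: (P s).
rewrite coef_sum; apply: eq_bigr => s _; rewrite signE coefCM (P s).2.
by congr (_ * _); apply: eq_bigr => i _; rewrite mxE.
Qed.

Lemma cmdet_line (R : comNzRingType) m (x b : 'cV[R]_(nedges m.+1)) :
  (size (cmdet (mxC x + 'X *: mxC b)) <= (m * 2).+1)%N /\
  (cmdet (mxC x + 'X *: mxC b))`_(m * 2) = cmdet b.
Proof.
rewrite /cmdet gram_quadratic; set W := (X in \det X).
have WE i j : W i j = (gram (sqv x) i j)%:P + 'X * (gram (\col_k (2 * x k 0 * b k 0)) i j)%:P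
    + 'X^2 * (gram (sqv b) i j)%:P by rewrite /W !mxE.
have [i j|sW ->] := @det_coef_top R m 2 W.
  rewrite WE; apply/leq_sizeP => l lt2l.
  rewrite !coefD coefC coefXM coefXnM !coefC.
  by case: l lt2l => [|[|[|l]]] //= _; rewrite !addr0.
split=> //; congr (\det _); apply/matrixP=> i j; rewrite [LHS]mxE WE.
by rewrite !coefD coefC coefXM coefXnM !coefC /= !add0r.
Qed.

Lemma cmdet_line_horner (R : comNzRingType) m (u v : 'cV[R]_(nedges m.+1)) t :
  (cmdet (mxC u + 'X *: mxC v)).[t] = cmdet (u + t *: v).
Proof.
rewrite -[LHS]/(horner_eval t _) -cmdet_map; congr cmdet.
by apply/matrixP=> k c; rewrite !mxE /= /horner_eval !hornerE.
Qed.

Lemma pencil_line (C : numClosedFieldType) m (W : 'M[{poly C}]_m) s : pencil W s ->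
  exists a b : 'cV[C]_(nedges m.+1), gram (sqv (mxC a + 'X *: mxC b)) = W.
Proof.
case=> symW WE.
have /fin_all_exists [gh ghE] (p : 'I_m * 'I_m) : exists gh : C * C,
    (p.1 = p.2 -> gh.1 = 0 /\ gh.2 = 0) /\
    W p.1 p.2 = (s p.1 + s p.2)%:P - (gh.1%:P + gh.2%:P * 'X) ^+ 2.
  by have [g [h H]] := WE p.1 p.2; exists (g, h).
pose f (i j : 'I_m.+1) : C * C := match unlift ord0 i, unlift ord0 j with
  | Some i', Some j' => gh (i', j')
  | Some i', None | None, Some i' => (sqrtC (s i'), 0)
  | None, None => (0, 0) end.
pose L i j : {poly C} := ((f i j).1%:P + (f i j).2%:P * 'X) ^+ 2.
have symL i j : L i j = L j i.
  rewrite /L /f; case: (unlift _ i) (unlift _ j) => [i'|] [j'|] //.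
  apply: (can_inj (subKr (s i' + s j')%:P)).
  by rewrite -(ghE (i', j')).2 [s i' + _]addrC -(ghE (j', i')).2 /= -{1}symW mxE.
have L0 i : L i i = 0.
  rewrite /L /f; case: (unlift _ i) => [i'|]; last by rewrite /= !polyC0 mul0r addr0 expr0n.
  by have [-> ->] := (ghE (i', i')).1 erefl; rewrite /= !polyC0 mul0r addr0 expr0n.
exists (\col_k (f (src k) (tgt k)).1), (\col_k (f (src k) (tgt k)).2).
have -> : sqv (mxC (\col_k (f (src k) (tgt k)).1) + 'X *: mxC (\col_k (f (src k) (tgt k)).2))
    = \col_k L (src k) (tgt k).
  by apply/matrixP=> k c; rewrite !mxE /L ['X * _]mulrC.
have distL i j : dist (\col_k L (src k) (tgt k)) i j = L i j.
  have [->|nij] := eqVneq i j; first by rewrite dist_diag L0.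
  exact: dist_col.
apply/matrixP=> i j; rewrite gram_entry !distL [L _ ord0]symL.
have L0l i' : L ord0 (lift ord0 i') = (s i')%:P.
  by rewrite /L /f unlift_none liftK /= polyC0 mul0r addr0 -polyC_exp sqrtCK.
by rewrite !L0l {1}/L /f !liftK (ghE (i, j)).2 polyCD.
Qed.

(** A polynomial with simple roots divides every polynomial that vanishes at them. *)
Lemma separable_root_dvdp (C : closedFieldType) (p q : {poly C}) : separable_poly p ->
  (forall x, root p x -> root q x) -> p %| q.
Proof.
move=> sepp rpq; have nzp := separable_poly_neq0 sepp.
have [rs Ep] := closed_field_poly_normal p.
have nzl : lead_coef p != 0 by rewrite lead_coef_eq0.
have urs : uniq rs by rewrite -separable_prod_XsubC -(eqp_separable (eqp_scale _ nzl)) -Ep.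
rewrite Ep dvdpZl // uniq_roots_dvdp ?uniq_rootsE //.
by apply/allP=> x xrs; apply: rpq; rewrite Ep rootZ // root_prod_XsubC.
Qed.

(** Let F = cmdet. Take a line a + t b on which F has full degree and only simple roots,
    and move it to pass through a given y in the pencil a + x (y - a) + t b. Full degree
    persists because the top coefficient is F(b), and simple roots persist for almost all
    x, by the resultant of F with its derivative. For those x the polynomial F(A .) in t
    vanishes at the roots of F and has no larger degree, so it is a constant multiple of F;
    the constant is the ratio of the values at b, the same on all the lines. A polynomial
    identity in x valid for almost all x holds at x = 1, t = 0, which is the point y. *)
Theorem cmdet_proportional (C : numClosedFieldType) m (A : 'M[C]_(nedges m.+1)) :
  (1 < m)%N -> (forall x, cmdet x = 0 -> cmdet (A *m x) = 0) ->
  exists c, forall x, cmdet (A *m x) = c * cmdet x.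
Proof.
move=> gt1m AL; have nm1 : m != 1%N by rewrite neq_ltn gt1m orbT.
have [W [s /pencil_line[a [b EW]] [sepW szW _]]] := simple_pencil_exists C nm1.
pose p0 := cmdet (mxC a + 'X *: mxC b).
have Ep0 : p0 = \det W by rewrite /p0 /cmdet EW.
have nzFb : cmdet b != 0.
  rewrite -(cmdet_line a b).2 -/p0 Ep0.
  have -> : (m * 2)%N = (size (\det W)).-1 by rewrite szW; lia.
  by rewrite -lead_coefE lead_coef_eq0 separable_poly_neq0.
exists (cmdet (A *m b) / cmdet b) => y.
pose ae : 'cV[{poly C}]_(nedges m.+1) := mxC a + 'X *: mxC (y - a).
pose P : {poly {poly C}} := cmdet (mxC ae + 'X *: mxC (mxC b)).
pose at_ (x : C) : 'cV_(nedges m.+1) := a + x *: (y - a).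
have aeE x : map_mx (horner_eval x) ae = at_ x.
  apply/matrixP=> k c; rewrite !mxE /= /horner_eval !hornerE; ring.
have PE x : map_poly (horner_eval x) P = cmdet (mxC (at_ x) + 'X *: mxC b).
  rewrite -(cmdet_map (map_poly (horner_eval x))); congr cmdet.
  rewrite -aeE; apply/matrixP=> k c; rewrite !mxE rmorphD rmorphM /= map_polyX !map_polyC /=.
  by rewrite /horner_eval hornerC.
have [szP PE2] := cmdet_line ae (mxC b); rewrite -/P in szP PE2.
have FbE : cmdet (mxC b) = (cmdet b)%:P by rewrite cmdet_map.
have szP' : size P = (m * 2).+1.
  apply/eqP; rewrite eqn_leq szP ltnNge; apply: contra nzFb => le_sz.
  by rewrite -polyC_eq0 -FbE -PE2 nth_default.
have leadP : lead_coef P = (cmdet b)%:P by rewrite lead_coefE szP' PE2 FbE.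
have m2_gt0 : (0 < m * 2)%N by rewrite muln_gt0 (ltnW gt1m).
have nzP : P != 0 by rewrite -size_poly_eq0 szP'.
have leadP' : lead_coef P^`() = (cmdet b *+ (m * 2))%:P.
  have cE : P^`()`_(m * 2).-1 = (cmdet b *+ (m * 2))%:P.
    by rewrite coef_deriv prednK // PE2 FbE rmorphMn.
  rewrite -cE lead_coefE; congr (_`_ _.-1); apply/eqP; rewrite eqn_leq.
  have := lt_size_deriv nzP; rewrite szP' ltnS => -> /=.
  rewrite leqNgt; apply: contra nzFb => lt_sz.
  have /eqP := cE; rewrite nth_default ?ltnS; last by rewrite -ltnS prednK.
  by rewrite eq_sym polyC_eq0 mulrn_eq0 -[_ == 0%N]negbK -lt0n m2_gt0.
(* P is a polynomial in t over polynomials in x, and rE says that r specializes well. *)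
pose r := resultant P P^`().
have rE x : r.[x] = resultant (cmdet (mxC (at_ x) + 'X *: mxC b))
    (cmdet (mxC (at_ x) + 'X *: mxC b))^`().
  rewrite -PE deriv_map -(map_resultant (f := horner_eval x)) //=.
    by rewrite leadP /horner_eval hornerC.
  by rewrite leadP' /horner_eval hornerC mulrn_eq0 negb_or nzFb -lt0n m2_gt0.
have at0 : at_ 0 = a by rewrite /at_ scale0r addr0.
have r0 : r.[0] != 0.
  rewrite rE at0 -/p0 Ep0 resultant_eq0 -leqNgt.
  by move: sepW; rewrite unlock /coprimep => /eqP->.
have prop x : r.[x] != 0 -> cmdet (A *m at_ x) = cmdet (A *m b) / cmdet b * cmdet (at_ x).
  rewrite rE resultant_eq0 -leqNgt; set p := cmdet _ => res.
  have [szp p2] := cmdet_line (at_ x) b; rewrite -/p in szp p2.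
  have nzp : p != 0 by apply: contraNneq nzFb => pz; rewrite -p2 pz coef0.
  have sepp : separable_poly p.
    rewrite unlock /coprimep eqn_leq res lt0n size_poly_eq0 gcdp_eq0 negb_and nzp.
    by [].
  pose q := cmdet (mxC (A *m at_ x) + 'X *: mxC (A *m b)).
  have [szq q2] := cmdet_line (A *m at_ x) (A *m b); rewrite -/q in szq q2.
  have /(separable_root_dvdp sepp)/dvdpP[k Ek] : forall t, root p t -> root q t.
    move=> t; rewrite /root !cmdet_line_horner scalemxAr -mulmxDr => /eqP/AL->.
    by rewrite eqxx.
  have szpE : size p = (m * 2).+1.
    apply/eqP; rewrite eqn_leq szp ltnNge; apply: contra nzFb => le_sz.
    by rewrite -p2 nth_default.
  have : (size k <= 1)%N.
    have [->|nzk] := eqVneq k 0; first by rewrite size_poly0.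
    by move: szq; rewrite Ek size_mul // szpE addnS /= -[X in (_ <= X)%N -> _]add1n leq_add2r.
  move/size1_polyC => Ek0; rewrite Ek0 mul_polyC in Ek.
  have E2 : cmdet (A *m b) = k`_0 * cmdet b by rewrite -q2 -p2 Ek coefZ.
  have := cmdet_line_horner (A *m at_ x) (A *m b) 0.
  have := cmdet_line_horner (at_ x) b 0.
  rewrite !scale0r !addr0 -/q -/p => <- <-.
  by rewrite E2 mulfK // Ek hornerZ.
(* D is the defect of proportionality at t = 0, as a polynomial in x. *)
pose D := cmdet (mxC A *m ae) - (cmdet (A *m b) / cmdet b)%:P * cmdet ae.
have DE x : D.[x] = cmdet (A *m at_ x) - cmdet (A *m b) / cmdet b * cmdet (at_ x).
  have -> : cmdet (A *m at_ x) = (cmdet (mxC A *m ae)).[x].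
    rewrite -[RHS]/(horner_eval x _) -cmdet_map map_mxM aeE.
    suff -> : map_mx (horner_eval x) (mxC A) = A by [].
    by apply/matrixP=> i j; rewrite !mxE /= /horner_eval hornerC.
  have -> : cmdet (at_ x) = (cmdet ae).[x].
    by rewrite -[RHS]/(horner_eval x _) -cmdet_map aeE.
  by rewrite hornerD hornerN hornerCM.
have : D * r = 0.
  apply: horner_eq0_poly => x; rewrite hornerM.
  by have [->|/prop Ex] := eqVneq r.[x] 0; rewrite ?mulr0 // DE Ex subrr mul0r.
move/eqP; rewrite mulf_eq0 => /orP[/eqP D0|/eqP rz]; last first.
  by rewrite rz horner0 eqxx in r0.
have := DE 1.
have -> : at_ 1 = y by rewrite /at_ scale1r addrC subrK.
rewrite D0 horner0 => /esym/eqP.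
by rewrite subr_eq0 => /eqP.
Qed.

(** * Linear maps preserving stars *)

Section Stars.
Variables (C : numClosedFieldType) (n : nat).
Local Notation N := (nedges n).
Implicit Types (w x y : 'cV[C]_N) (A B : 'M[C]_N) (i p q r : 'I_n) (k h g : 'I_N).

Lemma star_eq0 p x h : star p x -> (x h 0 == 0) = (p \notin endpoints h).
Proof.
case=> l nzl xE.
have -> : (x h 0 == 0) = (x h 0 ^+ 2 == 0) by rewrite expf_eq0.
by rewrite xE mulf_eq0 (negPf nzl) /=; case: (p \in _); rewrite ?eqxx ?oner_eq0.
Qed.

Definition flip k w : 'cV[C]_N := \col_h (if h == k then - w h 0 else w h 0).

Lemma star_flip i k w : star i w -> star i (flip k w).
Proof. by case=> l nzl wE; exists l => // h; rewrite mxE; case: eqP; rewrite ?sqrrN wE. Qed.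

Definition unit_star i : 'cV[C]_N := \col_h (i \in endpoints h)%:R.

Lemma unit_starP i : star i (unit_star i).
Proof.
exists 1; first exact: oner_neq0.
by move=> h; rewrite mxE mul1r; case: (i \in _); rewrite ?expr1n ?expr0n.
Qed.

Lemma fresh_vertex (s : seq 'I_n) : (size s < n)%N -> exists r, r \notin s.
Proof.
move=> lt_s; case: (pickP (fun r => r \notin s)) => [r|all_s]; first by exists r.
have : (#|'I_n| <= size s)%N.
  rewrite cardE; apply: uniq_leq_size (enum_uniq _) _ => r _.
  by apply/negbNE; rewrite all_s.
by rewrite card_ord leqNgt lt_s.
Qed.

(** The difference of stars at two distinct vertices p and q is nonzero on every edge
    that meets exactly one of them and zero on every edge that meets neither. With at
    least five vertices this support determines the pair {p, q}, hence both
    stars up to their order, except on the edge pq. *)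
Lemma star_difference p q p' q' x x' y y' : (4 < n)%N -> p != q ->
  star p x -> star q x' -> star p' y -> star q' y' -> x - x' = y - y' ->
  (forall h, ~~ ((p \in endpoints h) && (q \in endpoints h)) -> y h 0 = x h 0) \/
  (forall h, ~~ ((p \in endpoints h) && (q \in endpoints h)) -> y h 0 = - x' h 0).
Proof.
move=> gt4 npq sx sx' sy sy' Exy.
have E h : x h 0 - x' h 0 = y h 0 - y' h 0.
  by have /matrixP/(_ h 0) := Exy; rewrite !mxE.
have only a b (u v : 'cV[C]_N) h : star a u -> star b v -> a \in endpoints h ->
    b \notin endpoints h -> u h 0 - v h 0 != 0.
  move=> su sv ah bh; have /eqP-> : v h 0 == 0 by rewrite (star_eq0 _ sv).
  by rewrite subr0 (star_eq0 _ su) ah.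
have none a b (u v : 'cV[C]_N) h : star a u -> star b v -> a \notin endpoints h ->
    b \notin endpoints h -> u h 0 - v h 0 = 0.
  move=> su sv ah bh; have /eqP-> : v h 0 == 0 by rewrite (star_eq0 _ sv).
  by have /eqP-> : u h 0 == 0; rewrite ?subr0 // (star_eq0 _ su).
have swap (u v : 'cV[C]_N) h : u h 0 - v h 0 != 0 -> v h 0 - u h 0 != 0.
  by rewrite -opprB oppr_eq0.
(* Four edges from p and q to two other vertices have no vertex in common. *)
have npq' : p' != q'.
  apply/eqP=> epq; have [r nr] := @fresh_vertex [:: p; q] (ltn_trans (isT : 2 < 4)%N gt4).
  have [r' nr'] := @fresh_vertex [:: p; q; r] (ltn_trans (isT : 3 < 4)%N gt4).
  move: nr'; move: (nr); rewrite !inE !negb_or => /andP[rp rq] /and3P[r'p r'q r'r].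
  have in_edge a b : a \in [:: p; q] -> b \notin [:: p; q] -> p' \in [:: a; b].
    rewrite !inE !negb_or => apq /andP[bp bq].
    have nab : a != b by case/orP: apq => /eqP->; rewrite eq_sym.
    have [h Eh] := edge_exists nab; rewrite -in_set2 -Eh.
    apply: contraT => np'; have := E h.
    rewrite (none _ _ _ _ _ sy sy') -?epq // => /eqP; apply: contraLR => _.
    case/orP: apq => /eqP ea; subst a.
      by apply: (only _ _ _ _ _ sx sx'); rewrite Eh !inE ?eqxx // negb_or eq_sym npq eq_sym.
    by apply/swap/(only _ _ _ _ _ sx' sx); rewrite Eh !inE ?eqxx // negb_or npq eq_sym.
  have nr' : r' \notin [:: p; q] by rewrite !inE negb_or r'p.
  have pin : p \in [:: p; q] by rewrite !inE eqxx.
  have qin : q \in [:: p; q] by rewrite !inE eqxx orbT.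
  have e1 := in_edge p r pin nr; have e2 := in_edge q r qin nr.
  have e3 := in_edge p r' pin nr'; have e4 := in_edge q r' qin nr'.
  move: e1 e2 e3 e4; rewrite !inE.
  have [->|_] := eqVneq p' r; first by rewrite (negPf rp) (negPf rq) /= eq_sym (negPf r'r).
  by rewrite !orbF => /eqP-> ; rewrite (negPf npq).
(* A vertex a outside {p, q} would have an edge missing p, q and b. *)
have mem a b (u v : 'cV[C]_N) : a != b -> star a u -> star b v ->
    (forall h, p \notin endpoints h -> q \notin endpoints h -> u h 0 - v h 0 = 0) ->
    a \in [:: p; q].
  move=> nab su sv uv0; apply: contraT => na.
  have [r nr] := @fresh_vertex [:: p; q; a; b] gt4.
  move: na nr; rewrite !inE !negb_or => /andP[ap aq] /and4P[rp rq ra rb].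
  have nar : a != r by rewrite eq_sym.
  have [h Eh] := edge_exists nar.
  have ph : p \notin endpoints h by rewrite Eh !inE negb_or ![p == _]eq_sym ap rp.
  have qh : q \notin endpoints h by rewrite Eh !inE negb_or ![q == _]eq_sym aq rq.
  have bh : b \notin endpoints h by rewrite Eh !inE negb_or ![b == _]eq_sym nab rb.
  have ah : a \in endpoints h by rewrite Eh !inE eqxx.
  by have := only _ _ _ _ _ su sv ah bh; rewrite uv0 // eqxx.
have yy0 h : p \notin endpoints h -> q \notin endpoints h -> y h 0 - y' h 0 = 0.
  by move=> ph qh; rewrite -E (none _ _ _ _ _ sx sx').
have p'_in := mem _ _ _ _ npq' sy sy' yy0.
have q'_in : q' \in [:: p; q].
  apply: (mem _ p' y' y) => //; first by rewrite eq_sym.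
  by move=> h ph qh; rewrite -opprB yy0 ?oppr0.
move: p'_in q'_in npq'; rewrite !inE => /orP[] /eqP e1 /orP[] /eqP e2; subst p' q';
  rewrite ?eqxx // => _; [left | right] => h; rewrite negb_and => nh.
- have [ph|nph] := boolP (p \in endpoints h); last first.
    by apply/eqP; rewrite eq_sym; move: (star_eq0 h sx) (star_eq0 h sy); rewrite nph => /eqP-> /eqP->.
  rewrite ph /= in nh; have := E h.
  move: (star_eq0 h sx') (star_eq0 h sy'); rewrite nh => /eqP-> /eqP->.
  by rewrite !subr0.
- have [qh|nqh] := boolP (q \in endpoints h); last first.
    by move: (star_eq0 h sx') (star_eq0 h sy); rewrite nqh => /eqP-> /eqP->; rewrite oppr0.
  rewrite qh orbF in nh; have := E h.
  move: (star_eq0 h sx) (star_eq0 h sy'); rewrite nh => /eqP-> /eqP->.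
  by rewrite sub0r subr0.
Qed.

Definition star_preserving A := forall i w, star i w -> exists p, star p (A *m w).

Lemma flip_difference k w : w - flip k w = 2 * w k 0 *: delta_mx k 0.
Proof.
apply/matrixP=> h c; rewrite {c}ord1 !mxE andbT.
by case: eqP => [->|_] /=; ring.
Qed.

Lemma supported_parallel A p q (x y : 'cV[C]_N) : A \in unitmx -> p != q -> y != 0 ->
  (forall h, ~~ ((p \in endpoints h) && (q \in endpoints h)) -> (A *m x) h 0 = 0) ->
  (forall h, ~~ ((p \in endpoints h) && (q \in endpoints h)) -> (A *m y) h 0 = 0) ->
  exists c, x = c *: y.
Proof.
move=> uA npq nzy x0 y0; have [g Eg] := edge_exists npq.
have supp (v : 'cV[C]_N) : (forall h, ~~ ((p \in endpoints h) && (q \in endpoints h)) ->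
    v h 0 = 0) -> v = v g 0 *: delta_mx g 0.
  move=> v0; apply/matrixP=> h c; rewrite {c}ord1 !mxE andbT.
  have [->|nhg] := eqVneq h g; rewrite ?mulr1 // mulr0 v0 //.
  apply: contra nhg => /andP[ph qh]; apply/eqP/endpoints_inj.
  by rewrite Eg; apply: endpoints_set2.
have nzAy : (A *m y) g 0 != 0.
  apply: contraNneq nzy => yg0; rewrite -(mulKmx uA y) (supp _ y0) yg0 scale0r.
  by rewrite mulmx0.
exists ((A *m x) g 0 / (A *m y) g 0).
apply: (can_inj (mulKmx uA)); rewrite -scalemxAr [LHS](supp _ x0) [X in _ = _ *: X](supp _ y0).
by rewrite scalerA divfK.
Qed.

(** Let W be a star at i and W' the same with one sign changed, on the edge k.
    Changing further signs on an edge k1 or k2 leaves the difference W - W' unchanged, so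
    if the images of W and W' were stars at distinct vertices p, q, the images of the
    modified pairs would be the same two stars up to order and up to the edge pq. Then two
    vectors, each of the form flip h W - W or flip h W + W', would be mapped to the single
    line of the edge pq; the values on k1, k2 and a third edge k3 show that they are not
    proportional. *)
Lemma flip_same_vertex A i k p q : (4 < n)%N -> A \in unitmx -> star_preserving A ->
  i \in endpoints k -> star p (A *m unit_star i) -> star q (A *m flip k (unit_star i)) ->
  p = q.
Proof.
move=> gt4 uA presA ik sp sq; apply/eqP; apply: contraT => npq.
pose w := unit_star i; have sw : star i w := unit_starP i.
have w1 h : i \in endpoints h -> w h 0 = 1 by rewrite mxE => ->.
(* Besides k there are three more edges at i, because n >= 5. *)
have three_edges : exists k1 k2 k3, [/\ i \in endpoints k1, i \in endpoints k2,
    i \in endpoints k3 & uniq [:: k; k1; k2; k3]].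
  have edge_to r : r \notin endpoints k -> exists2 h, i \in endpoints h &
      forall r', (r' \in endpoints h) = (r' == i) || (r' == r).
    move=> nr; have nir : i != r by apply: contraNneq nr => <-.
    by have [h Eh] := edge_exists nir; exists h => [|r']; rewrite Eh !inE ?eqxx.
  have [r1] := @fresh_vertex [:: src k; tgt k] (ltn_trans (isT : 2 < 4)%N gt4).
  have [r2] := @fresh_vertex [:: src k; tgt k; r1] (ltn_trans (isT : 3 < 4)%N gt4).
  have [r3] := @fresh_vertex [:: src k; tgt k; r1; r2] gt4.
  have out r (s : seq 'I_n) : r \notin [:: src k, tgt k & s] ->
      r \notin endpoints k /\ r \notin s.
    by rewrite in_endpoints !inE !negb_or => /and3P[-> ->].
  move=> /out[o3 n3] /out[o2 n2] /out[o1 _].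
  have [k1 ik1 E1] := edge_to r1 o1; have [k2 ik2 E2] := edge_to r2 o2.
  have [k3 ik3 E3] := edge_to r3 o3; exists k1, k2, k3; split=> //.
  have ne r h h' : r \in endpoints h' -> r \notin endpoints h -> h != h'.
    by move=> rh' rh; apply: contraNneq rh => ->.
  have ni r : r \notin endpoints k -> (r == i) = false.
    by move=> nr; apply: contraNF nr => /eqP->.
  move: n2 n3; rewrite !inE !negb_or => n21 /andP[n31 n32].
  rewrite /= !inE !negb_or !andbT; apply/and3P; split; first apply/and3P; last 2 first.
  - apply/andP; split; first by apply: (ne r2); rewrite ?E2 ?E1 ?eqxx ?orbT // ni.
    by apply: (ne r3); rewrite ?E3 ?E1 ?eqxx ?orbT // ni.
  - by apply: (ne r3); rewrite ?E3 ?E2 ?eqxx ?orbT // ni.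
  split; [apply: (ne r1) | apply: (ne r2) | apply: (ne r3)];
    by rewrite ?E1 ?E2 ?E3 ?eqxx ?orbT.
have [k1 [k2 [k3 [ik1 ik2 ik3]]]] := three_edges.
rewrite /= !inE !negb_or !andbT => /and3P[/and3P[n1 n2 n3] /andP[n12 n13] n23].
have cases h : i \in endpoints h -> k != h -> exists x : 'cV[C]_N,
    (x = flip h w - w \/ x = flip h w + flip k w) /\
    forall g, ~~ ((p \in endpoints g) && (q \in endpoints g)) -> (A *m x) g 0 = 0.
  move=> ih nkh; have swh := star_flip h sw.
  have [p' sp'] := presA _ _ swh; have [q' sq'] := presA _ _ (star_flip k swh).
  have E : A *m w - A *m flip k w = A *m flip h w - A *m flip k (flip h w).
    rewrite -!mulmxBr !flip_difference; congr (A *m (2 * _ *: _)).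
    by rewrite [RHS]mxE (negPf nkh).
  case: (star_difference gt4 npq sp sq sp' sq' E) => [Dw|Dw].
    exists (flip h w - w); split; first by left.
    by move=> g ng; rewrite mulmxBr mxE [X in _ + X]mxE Dw ?subrr.
  exists (flip h w + flip k w); split; first by right.
  by move=> g ng; rewrite mulmxDr mxE Dw // addNr.
have [x [xE x0]] := cases k1 ik1 n1; have [y [yE y0]] := cases k2 ik2 n2.
have nonpar (u v : 'cV[C]_N) g : u g 0 != 0 -> v g 0 = 0 -> ~ exists c, u = c *: v.
  by move=> ug vg [c E]; move: ug; rewrite E mxE vg mulr0 eqxx.
have val1 h g : i \in endpoints g -> (flip h w - w) g 0 = if g == h then - 2 else 0.
  by move=> ig; rewrite !mxE ig; case: eqP => _ /=; ring.
have val2 h g : i \in endpoints g -> h != k -> (flip h w + flip k w) g 0 =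
    if (g == h) || (g == k) then 0 else 2.
  move=> ig nhk; rewrite !mxE ig; have [->|_] := eqVneq g h.
    by rewrite (negPf nhk) addNr.
  by have [_|_] := eqVneq g k; rewrite ?subrr //=; ring.
have nz2 : 2 != 0 :> C by rewrite pnatr_eq0.
have nzN2 : - 2 != 0 :> C by rewrite oppr_eq0.
have nz (u : 'cV[C]_N) g : u g 0 != 0 -> u != 0.
  by apply: contraNneq => ->; rewrite mxE.
have par u v : v != 0 -> (forall g, ~~ ((p \in endpoints g) && (q \in endpoints g)) ->
     (A *m u) g 0 = 0) -> (forall g, ~~ ((p \in endpoints g) && (q \in endpoints g)) ->
     (A *m v) g 0 = 0) -> exists c, u = c *: v := @supported_parallel A p q u v uA npq.
have ek1 : k1 == k = false by rewrite eq_sym (negPf n1).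
have ek2 : k2 == k = false by rewrite eq_sym (negPf n2).
have ek3 : k3 == k = false by rewrite eq_sym (negPf n3).
have e31 : k3 == k1 = false by rewrite eq_sym (negPf n13).
have e32 : k3 == k2 = false by rewrite eq_sym (negPf n23).
have e21 : k2 == k1 = false by rewrite eq_sym (negPf n12).
have e12 : k1 == k2 = false by rewrite (negPf n12).
case: xE x0 => -> x0; case: yE y0 => -> y0.
- case: (@nonpar (flip k1 w - w) (flip k2 w - w) k1); rewrite ?val1 ?eqxx ?e12 //.
  by apply: par => //; apply: (nz _ k2); rewrite val1 ?eqxx.
- case: (@nonpar (flip k2 w + flip k w) (flip k1 w - w) k3).
  + by rewrite val2 ?ek2 // e32 ek3.
  + by rewrite val1 ?e31.
  by apply: par => //; apply: (nz _ k1); rewrite val1 ?eqxx.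
- case: (@nonpar (flip k1 w + flip k w) (flip k2 w - w) k3).
  + by rewrite val2 ?ek1 // e31 ek3.
  + by rewrite val1 ?e32.
  by apply: par => //; apply: (nz _ k2); rewrite val1 ?eqxx.
- case: (@nonpar (flip k1 w + flip k w) (flip k2 w + flip k w) k2).
  + by rewrite val2 ?ek1 // e21 ek2.
  + by rewrite val2 ?ek2 // eqxx.
  by apply: par => //; apply: (nz _ k1); rewrite val2 ?ek2 // e12 ek1.
Qed.

(** The vector of an edge k at i is half the difference of two stars at i whose images are
    stars at one vertex f i, so its image is supported on the edges at f i. *)
Lemma column_support A : (4 < n)%N -> A \in unitmx -> star_preserving A ->
  exists f : 'I_n -> 'I_n, (forall i, star (f i) (A *m unit_star i)) /\
    forall i k h, i \in endpoints k -> f i \notin endpoints h -> A h k = 0.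
Proof.
move=> gt4 uA presA.
have /fin_all_exists [f fP] i : exists p, star p (A *m unit_star i).
  exact: presA (unit_starP i).
exists f; split=> // i k h ik fh.
have [q sq] := presA _ _ (star_flip k (unit_starP i)).
have Eq := flip_same_vertex gt4 uA presA ik (fP i) sq; rewrite -Eq in sq.
have : (A *m (unit_star i - flip k (unit_star i))) h 0 = 0.
  rewrite mulmxBr mxE [X in _ + X]mxE.
  by move: (star_eq0 h (fP i)) (star_eq0 h sq); rewrite fh => /eqP-> /eqP->; rewrite subr0.
rewrite flip_difference -scalemxAr -colE [unit_star _ _ _]mxE ik mxE mxE => /eqP.
by rewrite mulr1 mulf_eq0 pnatr_eq0 => /eqP.
Qed.

Lemma vertex_map_cancel A B (f f' : 'I_n -> 'I_n) : (2 < n)%N -> B *m A = 1%:M ->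
  (forall i k h, i \in endpoints k -> f i \notin endpoints h -> A h k = 0) ->
  (forall i k h, i \in endpoints k -> f' i \notin endpoints h -> B h k = 0) ->
  cancel f f'.
Proof.
move=> gt2 BA fA f'B i; apply/eqP; apply: contraT => ne.
have [r] := @fresh_vertex [:: i; f' (f i)] gt2; rewrite !inE negb_or => /andP[ri rf].
have nir : i != r by rewrite eq_sym.
have [k Ek] := edge_exists nir.
have ik : i \in endpoints k by rewrite Ek !inE eqxx.
have : (B *m A) k k = 0.
  rewrite mxE big1 // => g _.
  have [fg|nfg] := boolP (f i \in endpoints g); last by rewrite (fA i) ?mulr0.
  by rewrite (f'B (f i)) ?mul0r // Ek !inE negb_or ne eq_sym.
by rewrite BA mxE eqxx => /eqP; rewrite oner_eq0.
Qed.

Lemma edge_perm (t : 'S_n) : exists s : 'S_N, induces t s.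
Proof.
have /fin_all_exists [f fE] k : exists h, endpoints h = (t @: endpoints k)%SET.
  have nt : t (src k) != t (tgt k) by rewrite (inj_eq perm_inj) src_neq_tgt.
  have [h Eh] := edge_exists nt.
  by exists h; rewrite Eh imsetU1 imset_set1.
have f_inj : injective f.
  move=> k h Ekh; apply: endpoints_inj; apply: (imset_inj (@perm_inj _ t)).
  by rewrite -!fE Ekh.
by exists (perm f_inj) => k; rewrite permE fE.
Qed.

Lemma square_constant (c : 'I_N -> C) :
  (forall i k h, i \in endpoints k -> i \in endpoints h -> c k ^+ 2 = c h ^+ 2) ->
  forall k h, c k ^+ 2 = c h ^+ 2.
Proof.
move=> cE k h; have ik : src k \in endpoints k by rewrite in_endpoints eqxx.
have ih : src h \in endpoints h by rewrite in_endpoints eqxx.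
have [e|ne] := eqVneq (src k) (src h); first by apply: (cE (src k)); rewrite // e.
have [g Eg] := edge_exists ne; transitivity (c g ^+ 2).
  by apply: (cE (src k)); rewrite // Eg !inE eqxx.
by apply: (cE (src h)); rewrite // Eg !inE eqxx orbT.
Qed.

End Stars.

(** The image of the vector of an edge ij is supported on the edges common to f i and f j,
    hence on a single edge, f being injective by [vertex_map_cancel]. So the matrix is
    monomial, and since the image of the sum of the edges at i is a star, the squares of
    its nonzero entries agree on edges that share a vertex, hence on all edges. *)
Theorem star_preserving_monomial (C : numClosedFieldType) n (A : 'M[C]_(nedges n)) :
  (4 < n)%N -> A \in unitmx -> star_preserving A -> star_preserving (invmx A) ->
  exists (c : C) (e : 'rV_(nedges n)) (s : 'S_(nedges n)),
    [/\ forall k, e 0 k = 1 \/ e 0 k = -1, exists t : 'S_n, induces t s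
      & A = c *: (diag_mx e *m perm_mx s)].
Proof.
move=> gt4 uA presA presA'; have gt2 : (2 < n)%N by apply: ltn_trans gt4.
have [f [fP fA]] := column_support gt4 uA presA.
have [f' [_ f'A]] : exists f' : 'I_n -> 'I_n, _ := column_support gt4 (etrans (unitmx_inv A) uA) presA'.
have f_inj := can_inj (vertex_map_cancel gt2 (mulVmx uA) fA f'A).
pose t := perm f_inj; have [s0 s0E] := edge_perm t.
have A0 h k : h != s0 k -> A h k = 0.
  move=> ne; have [fs|] := boolP (f (src k) \in endpoints h); last first.
    by apply: fA; rewrite in_endpoints eqxx.
  have [ft|] := boolP (f (tgt k) \in endpoints h); last first.
    by apply: fA; rewrite in_endpoints eqxx orbT.
  case/eqP: ne; apply: endpoints_inj; rewrite s0E imsetU1 imset_set1 !permE.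
  by apply: endpoints_set2 fs ft; rewrite (inj_eq f_inj) src_neq_tgt.
(* The only entry of column k that may be nonzero. *)
pose c k := A (s0 k) k.
have cE i k h : i \in endpoints k -> i \in endpoints h -> c k ^+ 2 = c h ^+ 2.
  have [l nzl lE] := fP i.
  have val k' : i \in endpoints k' -> c k' ^+ 2 = l.
    move=> ik'; have := lE (s0 k'); rewrite s0E -[f i](permE f_inj) mem_imset ?ik' ?mulr1 //;
      last exact: perm_inj.
    move=> <-; congr (_ ^+ 2); rewrite mxE (bigD1 k') //= big1 => [|g ng].
      by rewrite mxE ik' mulr1 addr0.
    by rewrite A0 ?mul0r // (inj_eq perm_inj) eq_sym.
  by move=> /val-> /val->.
have c2 := square_constant cE.
pose vertex0 := Ordinal (ltn_trans (isT : 0 < 4)%N gt4).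
have [r] := @fresh_vertex n [:: vertex0] (ltn_trans (isT : 1 < 4)%N gt4).
rewrite inE eq_sym => /edge_exists [k0 _].
have nzc : c k0 != 0.
  apply: contraTneq uA => ck0; rewrite unitmxE unitfE negbK.
  suff -> : A = 0.
    have lt0N : (0 < nedges n)%N by apply: leq_ltn_trans (ltn_ord k0).
    by rewrite -(prednK lt0N) det0.
  apply/matrixP=> h k; rewrite mxE; have [->|/A0//] := eqVneq h (s0 k).
  by have := c2 k k0; rewrite ck0 expr0n => /eqP; rewrite expf_eq0 => /eqP.
exists (c k0), (\row_h (c ((s0^-1)%g h) / c k0)), (s0^-1)%g; split.
- move=> k; apply/pred2P; rewrite mxE -sqrf_eq1 expr_div_n (c2 _ k0) divff //.
  by rewrite expf_neq0.
- exists (t^-1)%g => k; rewrite -{2}(permKV s0 k) s0E -imset_comp.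
  by rewrite -[LHS]imset_id; apply: eq_imset => i; rewrite /= permK.
apply/matrixP=> h k; rewrite mul_diag_mx !mxE.
have [Ek|nk] := eqVneq ((s0^-1)%g h) k; last first.
  by rewrite !mulr0 A0 //; apply: contra nk => /eqP->; rewrite permK.
by rewrite mulr1 mulrC divfK // Ek /c -Ek permKV.
Qed.

(** * Automorphisms of the variety *)

(** A linear map that preserves a polynomial up to a constant preserves its multiplicities. *)
Lemma has_mult_mulmx (C : numClosedFieldType) m q (A : 'M[C]_(nedges m.+1)) c w :
  A \in unitmx -> (forall x, cmdet (A *m x) = c * cmdet x) ->
  has_mult q w -> has_mult q (A *m w).
Proof.
move=> uA AE mw u.
have -> : cmdet (mxC (A *m w) + 'X *: mxC u)
    = c%:P * cmdet (mxC w + 'X *: mxC (invmx A *m u)).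
  apply/eqP; rewrite -subr_eq0; apply/eqP/horner_eq0_poly => x.
  rewrite hornerD hornerN hornerCM [X in X - _]cmdet_line_horner [X in _ * X]cmdet_line_horner.
  have -> : A *m w + x *: u = A *m (w + x *: (invmx A *m u)).
    by rewrite mulmxDr -scalemxAr (mulKVmx uA).
  by rewrite AE subrr.
by rewrite dvdp_mull.
Qed.

Lemma star_neq0 (C : numClosedFieldType) m (i : 'I_m.+2) (w : 'cV[C]_(nedges m.+2)) :
  star i w -> w != 0.
Proof.
move=> sw; apply/eqP=> w0.
have [k Ek] := edge_exists (neq_lift i (ord0 : 'I_m.+1)).
have := star_eq0 k sw; rewrite w0 mxE eqxx Ek !inE eqxx.
by [].
Qed.

Lemma star_image (C : numClosedFieldType) d (A : 'M[C]_(nedges d.+2)) :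
  (0 < d)%N -> A \in unitmx -> (forall x, cmdet x = 0 -> cmdet (A *m x) = 0) ->
  star_preserving A.
Proof.
move=> d_gt0 uA AL i w sw; have [c cE] := cmdet_proportional (d_gt0 : (1 < d.+1)%N) AL.
apply: star_of_mult; last exact: has_mult_mulmx uA cE (mult_of_star sw).
by apply: contraNneq (star_neq0 sw) => Aw0; rewrite -(mulKmx uA w) Aw0 mulmx0.
Qed.

Unset Implicit Arguments.

Theorem theorem6p7 (R : realType) (d : nat) (hd : (3 <= d)%N)
    (A : 'M[R[i]]_(nedges d.+2)) :
  linear_automorphism A (L_variety R d d.+2) ->
  exists (c : R[i]) (B : 'M[R[i]]_(nedges d.+2)),
    relabeling_signed_perm B /\ A = c *: B.
Proof.
case=> uA AL; have d_gt0 : (0 < d)%N by apply: leq_trans hd.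
have presA : star_preserving A.
  apply: (star_image d_gt0 uA) => x x0; apply/(@L_varietyP R); rewrite -AL.
  by exists x; first exact/(@L_varietyP R).
have presA' : star_preserving (invmx A).
  have uA' : invmx A \in unitmx by rewrite unitmx_inv.
  apply: (star_image d_gt0 uA') => x /(@L_varietyP R); rewrite -{1}AL => -[y Ly <-].
  by rewrite (mulKmx uA); apply/(@L_varietyP R).
have [c [e [s [e1 st ->]]]] := star_preserving_monomial (hd : (4 < d.+2)%N) uA presA presA'.
exists c, (diag_mx e *m perm_mx s); split=> //.
by exists (diag_mx e), s; split=> //; exists e.
Qed.
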